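(* Each spacelike surface with parallel normalized mean curvature vector field in the Minkowski space $\mathbb{E}^4_1$ locally admits canonical parameters, i.e. local parameters $(u,v)$ whose first fundamental form coefficients satisfy $$E(u,v) = G(u,v) = \frac{1}{|\mu(u,v)|}, \qquad F(u,v)=0,$$ where $\mu$ is the geometric function of the surface defined in the context.
   Context: $\mathbb{E}^4_1$ is $\mathbb{R}^4$ with a flat metric $\langle\cdot,\cdot\rangle$ of signature $(3,1)$ and Levi-Civita connection $\nabla'$. A surface $M^2\subset\mathbb{E}^4_1$ is spacelike if the induced metric is positive definite. Let $\nabla$ be its Levi-Civita connection, $\sigma$ its second fundamental form, $A_\xi$ its shape operators and $D$ its normal connection: $\nabla'_XY=\nabla_XY+\sigma(X,Y)$, $\nabla'_X\xi=-A_\xi X+D_X\xi$ for tangent $X,Y$ and normal $\xi$. The mean curvature vector field is $H=\frac12\operatorname{tr}\sigma$. $M^2$ is a surface with parallel normalized mean curvature vector field if $H$ is non-zero and there exists a unit vector field $b$ in the direction of $H$ (so $\langle b,b\rangle=\varepsilon=\pm1$, with $\varepsilon=1$ if $H$ is spacelike and $\varepsilon=-1$ if $H$ is timelike) which is parallel in the normal bundle, i.e. $Db=0$ identically. Geometric frame and functions: the geometric frame field of such a surface is an orthonormal frame field $\{x,y,b,l\}$ with $x,y$ tangent to $M^2$ (tangent to the so-called principal lines), $b,l$ normal to $M^2$, $b$ collinear with $H$, $\langle b,b\rangle=\varepsilon$, $\langle l,l\rangle=-\varepsilon$, and $$\sigma(x,x)=\nu_1b,\qquad \sigma(x,y)=\lambda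 b+\mu l,\qquad \sigma(y,y)=\nu_2b .$$ The functions $\nu_1,\nu_2,\lambda,\mu$ are among the geometric functions of the surface. For a parametrization $z=z(u,v)$ of $M^2$, $E=\langle z_u,z_u\rangle$, $F=\langle z_u,z_v\rangle$, $G=\langle z_v,z_v\rangle$.
   Formalization: Canonical parameters are claimed near each point where μ ≠ 0; where μ = 0 (for example on a round sphere in a Euclidean E^3 inside E^4_1, which has parallel normalized mean curvature vector field) 1/|μ| is undefined. *)

(* Defs.v *)
From mathcomp Require Import all_boot all_order all_algebra.
From mathcomp Require Import all_classical all_reals all_analysis.

Set Implicit Arguments.
Unset Strict Implicit.
Unset Printing Implicit Defensive.

Import Order.TTheory GRing.Theory Num.Theory.
Import numFieldNormedType.Exports.

Local Open Scope classical_set_scope.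
Local Open Scope ring_scope.

Section Smoothness.
Context {R : realType}.

(* Meant for open U: 'D_v f is a total function, but its values on U only
   depend on f on U when U is open. *)
Fixpoint Ck {V W : normedModType R} (k : nat) (U : set V) (f : V -> W) : Prop :=
  match k with
  | 0%N => forall p, U p -> {for p, continuous f}
  | k'.+1 => (forall p, U p -> differentiable f p) /\
             (forall v : V, Ck k' U ('D_v f))
  end.

Definition smooth {V W : normedModType R} (U : set V) (f : V -> W) : Prop :=
  forall k, Ck k U f.

Definition diffeomorphism {V W : normedModType R}
    (A : set V) (B : set W) (phi : V -> W) : Prop :=
  [/\ open A, open B, smooth A phi, (forall q, A q -> B (phi q)) &
      exists psi : W -> V,
        [/\ smooth B psi, (forall p, B p -> A (psi p)),
            (forall q, A q -> psi (phi q) = q) &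
            (forall p, B p -> phi (psi p) = p)]].

End Smoothness.

Section SpacelikeSurfaces.
Context {R : realType}.

(* E^4_1 is 'rV[R]_4 with the first three coordinates spacelike and the last
   one timelike. *)
Definition mink (a b : 'rV[R]_4) : R :=
  \sum_(i < 4) (if i == ord_max then -1 else 1) * (a 0 i * b 0 i).

(* A surface is an immersed patch z = z(u, v), (u, v) = p ranging over an open
   set of R^2.  A tangent vector at the point of parameter p is represented by
   its coordinates v : 'rV[R]_2; as a vector of E^4_1 it is 'D_v z p.  Since
   E^4_1 is flat, the ambient covariant derivative in the direction v of a
   field xi along the patch is 'D_v xi p. *)
Implicit Types (z : 'rV[R]_2 -> 'rV[R]_4) (p v w x y : 'rV[R]_2).

Definition du : 'rV[R]_2 := delta_mx 0 0.
Definition dv : 'rV[R]_2 := delta_mx 0 1.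

Definition first_form z p v w : R := mink ('D_v z p) ('D_w z p).

Definition coefE z p : R := first_form z p du du.
Definition coefF z p : R := first_form z p du dv.
Definition coefG z p : R := first_form z p dv dv.

(* Positive definiteness of the induced metric makes z an immersion. *)
Definition spacelike_surface (U : set 'rV[R]_2) z : Prop :=
  [/\ open U, smooth U z &
      forall p v, U p -> v != 0 -> 0 < first_form z p v v].

Definition normal_vector z p (xi : 'rV[R]_4) : Prop :=
  forall v, mink xi ('D_v z p) = 0.

Definition gram z p : 'M[R]_2 :=
  \matrix_(i, j) first_form z p (delta_mx 0 i) (delta_mx 0 j).

Definition tangential_part z p (a : 'rV[R]_4) : 'rV[R]_4 :=
  \sum_(i < 2) \sum_(j < 2)
    (invmx (gram z p) i j * mink a ('D_(delta_mx 0 j) z p)) *: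
      'D_(delta_mx 0 i) z p.

Definition normal_part z p (a : 'rV[R]_4) : 'rV[R]_4 :=
  a - tangential_part z p a.

(* sigma(v, w) is the normal part of nabla'_v Y for any tangent field Y
   extending w; here Y = 'D_w z is the extension with constant coordinates. *)
Definition sigma z p v w : 'rV[R]_4 := normal_part z p ('D_v ('D_w z) p).

(* H = tr(sigma) / 2, the trace being taken for the induced metric. *)
Definition mean_curvature z p : 'rV[R]_4 :=
  2^-1 *: \sum_(i < 2) \sum_(j < 2)
    invmx (gram z p) i j *: sigma z p (delta_mx 0 i) (delta_mx 0 j).

(* D_v xi, for a normal field xi. *)
Definition normal_connection z (xi : 'rV[R]_2 -> 'rV[R]_4) p v : 'rV[R]_4 :=
  normal_part z p ('D_v xi p).

Definition parallel_normalized_mean_curvature (U : set 'rV[R]_2) z : Prop :=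
  (forall p, U p -> mean_curvature z p != 0) /\
  exists b : 'rV[R]_2 -> 'rV[R]_4,
    [/\ smooth U b,
        (forall p, U p -> mink (b p) (b p) = 1 \/ mink (b p) (b p) = -1),
        (forall p, U p -> exists2 h : R, 0 < h & mean_curvature z p = h *: b p)
      & (forall p v, U p -> normal_connection z b p v = 0)].

(* The values at the point of parameter p of a geometric frame {x, y, b, l} and
   of the functions nu1, nu2, lambda, mu.  Every point of a surface with
   parallel normalized mean curvature admits such a frame; it is not unique,
   but `|mu| does not depend on its choice. *)
Definition geometric_frame z p x y (b l : 'rV[R]_4) (nu1 nu2 lambda mu : R) :
    Prop :=
  [/\ [/\ first_form z p x x = 1, first_form z p y y = 1 &
          first_form z p x y = 0],
      [/\ normal_vector z p b, normal_vector z p l, mink b l = 0 &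
          exists2 eps : R, eps = 1 \/ eps = -1 &
            mink b b = eps /\ mink l l = - eps],
      (exists h : R, mean_curvature z p = h *: b) &
      [/\ sigma z p x x = nu1 *: b,
          sigma z p x y = lambda *: b + mu *: l &
          sigma z p y y = nu2 *: b]].

Definition canonical_parameters (V : set 'rV[R]_2) z (mu : 'rV[R]_2 -> R) :
    Prop :=
  forall q, V q ->
    [/\ coefE z q = `|mu q|^-1, coefG z q = `|mu q|^-1 & coefF z q = 0].

End SpacelikeSurfaces.

(* Main.v *)
Require Import Defs.
From HB Require Import structures.
From mathcomp Require Import all_boot all_order all_algebra.
From mathcomp Require Import all_classical all_reals all_analysis.
From mathcomp Require Import ring lra.

Set Implicit Arguments.
Unset Strict Implicit.
Unset Printing Implicit Defensive.

Import Order.TTheory GRing.Theory Num.Theory.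
Import numFieldNormedType.Exports.

Local Open Scope classical_set_scope.
Local Open Scope ring_scope.

(** The canonical parameters are primitives of two closed 1-forms built from the
    first fundamental form g and from the second fundamental form along the
    normal direction orthogonal to the mean curvature vector.

    Let b be the parallel unit normal field in the direction of H and nu a smooth
    unit normal field orthogonal to b. As b is parallel, so is nu: the derivatives
    of nu are tangent ([parallel_normal_weingarten]). Put S(v, w) = <D_v D_w z, nu>
    and m = |mu|. In a geometric frame sigma(x, x) and sigma(y, y) are multiples
    of b, so S(x, x) = S(y, y) = 0, while S(x, y) = mu or - mu. Hence where mu does
    not vanish, (m g + S) / 2 and (m g - S) / 2 are positive semidefinite quadratic
    forms of rank one, that is, squares of 1-forms alpha and beta
    ([principal_square_factor], [principal_form_mul]):
      m g = alpha^2 + beta^2,   S = alpha^2 - beta^2.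
    With X, Y the tangent vectors dual to alpha, beta, carried to the ambient space,
      dz = alpha X + beta Y,   d nu = - m (alpha X - beta Y),
      <X, X> = <Y, Y> = 1 / m,   <X, Y> = 0.
    So alpha = m <X, dz> and also alpha = - <X, d nu>. Differentiating the two
    expressions, and using that dz and d nu are closed, gives two values of
    d alpha that are opposite to each other; hence d alpha = 0. Exchanging nu and
    - nu exchanges alpha and beta, so d beta = 0 too ([codazzi_closed],
    [coframe_closed]). This is the form that the Codazzi equation for S takes here.

    By the Poincare lemma ([closed_form_primitive]) alpha = du and beta = dv near
    p0; since m g is positive definite, alpha and beta are independent, so (u, v)
    are coordinates by the inverse function theorem ([inverse_function_theorem],
    [closed_coframe_coordinates]); and m g = du^2 + dv^2 says E = G = 1 / m, F = 0.

    The geometric frame is given point by point, without any regularity in the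
    point, so it serves only for identities at a fixed point. Every smooth object is
    given by a formula in z and b: nu is a normalized cross product
    ([smooth_unit_normal]), mu^2 a quotient of determinants
    ([extrinsic_squareE]), and alpha(v) = A(w, v) / sqrt A(w, w) for the form
    A = (m g + S) / 2 and a constant vector w with A(w, w) > 0. *)

(** * Calculus of maps of class C^k *)

Section CkCalculus.
Context {R : realType}.
Implicit Types V W : normedModType R.

Lemma near_open V (U : set V) (P : V -> Prop) p :
  open U -> U p -> (forall q, U q -> P q) -> \forall q \near p, P q.
Proof.
by move=> oU Up UP; apply: filterS (open_nbhs_nbhs (conj oU Up)).
Qed.

Lemma near_eq_differentiable V W (f g : V -> W) p :
  (\forall q \near p, f q = g q) -> differentiable f p -> differentiable g p.
Proof.
move=> fg /diff_locallyP[df Ef].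
have fgp : f p = g p by exact: nbhs_singleton fg.
have Eg : g \o shift p = cst (g p) + 'd f p +o_ 0 id.
  apply/eqaddoP => _/posnumP[e].
  move/eqaddoP : Ef => /(_ e%:num) /(_ [gt0 of e%:num]).
  have : \forall q \near (0 : V), f (q + p) = g (q + p).
    by move: fg; rewrite (near_shift 0 p); apply: filterS => q /=; rewrite subr0.
  apply: filterS2 => q Eq.
  by rewrite /= !fctE /= -Eq -fgp.
apply/diff_locallyP; have -> : 'd g p = 'd f p :> (V -> W).
  exact: diff_unique Eg.
by split.
Qed.

(** Derivatives are total functions, and the rules of calculus only identify them
    on the open set where the maps are differentiable; this lemma transfers the
    class across such identities, so the rules below go by induction on k. *)
Lemma Ck_eq V W k (U : set V) (f g : V -> W) :
  open U -> (forall p, U p -> f p = g p) -> Ck k U f -> Ck k U g.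
Proof.
elim: k f g => [|k IH] f g oU fg /=.
  move=> cf p Up; have fgp := fg _ Up.
  have Efg : \forall q \near p, f q = g q by exact: near_open fg.
  have h : f @ p --> f p := cf p Up.
  change (g @ p --> g p); rewrite -fgp.
  by apply: cvg_trans h; apply: near_eq_cvg.
move=> [df cf]; split.
  move=> p Up; apply: near_eq_differentiable (df p Up); exact: near_open fg.
move=> v; apply: IH (cf v) => // p Up.
by apply: near_eq_derive; exact: near_open fg.
Qed.

Lemma Ck_subset V W k (U U' : set V) (f : V -> W) :
  U' `<=` U -> Ck k U f -> Ck k U' f.
Proof.
move=> sU; elim: k f => [|k IH] f /=; first by move=> cf p /sU /cf.
by move=> [df cf]; split=> [p /sU /df //|v]; exact: IH.
Qed.

Lemma Ck_pred V W k (U : set V) (f : V -> W) : Ck k.+1 U f -> Ck k U f.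
Proof.
elim: k f => [|k IH] f [df cf].
  by move=> p Up; exact/differentiable_continuous/df.
by split=> // v; exact/IH/cf.
Qed.

Lemma Ck_cst V W k (U : set V) (c : W) : Ck k U (cst c).
Proof.
elim: k c => [|k IH] c /=; first by move=> p _; exact: cst_continuous.
split=> [p _|v]; first exact: differentiable_cst.
by rewrite (_ : 'D_v (cst c) = cst 0) //; apply/funext => p; rewrite derive_cst.
Qed.

Lemma Ck_add V W k (U : set V) (f g : V -> W) :
  open U -> Ck k U f -> Ck k U g -> Ck k U (fun p => f p + g p).
Proof.
move=> oU; elim: k f g => [|k IH] f g /=.
  by move=> cf cg p Up; apply: continuousD; [exact: cf|exact: cg].
move=> [df cf] [dg cg]; split=> [p Up|v].
  by apply: differentiableD; [exact: df|exact: dg].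
apply: Ck_eq (IH _ _ (cf v) (cg v)) => // p Up.
by rewrite (_ : (fun q => f q + g q) = f + g) // deriveD //; apply: diff_derivable;
  [exact: df|exact: dg].
Qed.

Lemma Ck_opp V W k (U : set V) (f : V -> W) :
  open U -> Ck k U f -> Ck k U (fun p => - f p).
Proof.
move=> oU; elim: k f => [|k IH] f /=.
  by move=> cf p Up; apply: continuousN; exact: cf.
move=> [df cf]; split=> [p Up|v]; first exact/differentiableN/df.
apply: Ck_eq (IH _ (cf v)) => // p Up.
by rewrite (_ : (fun q => - f q) = - f) // deriveN //; exact/diff_derivable/df.
Qed.

Lemma Ck_mul V k (U : set V) (f g : V -> R) :
  open U -> Ck k U f -> Ck k U g -> Ck k U (fun p => f p * g p).
Proof.
move=> oU; elim: k f g => [|k IH] f g.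
  by move=> cf cg p Up; apply: continuousM; [exact: cf|exact: cg].
move=> Cf Cg; have [df cf] := Cf; have [dg cg] := Cg; split=> [p Up|v].
  by apply: differentiableM; [exact: df|exact: dg].
apply: (Ck_eq oU _ (Ck_add oU (IH _ _ (Ck_pred Cf) (cg v))
                              (IH _ _ (Ck_pred Cg) (cf v)))) => p Up.
by rewrite (_ : (fun q => f q * g q) = f * g) // deriveM //; apply: diff_derivable;
  [exact: df|exact: dg].
Qed.

Lemma Ck_sum V W k (U : set V) (I : Type) (r : seq I) (P : pred I)
    (f : I -> V -> W) :
  open U -> (forall i, Ck k U (f i)) -> Ck k U (fun p => \sum_(i <- r | P i) f i p).
Proof.
move=> oU cf; elim: r => [|i r IH].
  apply: (Ck_eq oU _ (Ck_cst k U 0)) => p _; by rewrite big_nil.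
case Pi : (P i); last first.
  by apply: (Ck_eq oU _ IH) => p _; rewrite big_cons Pi.
by apply: (Ck_eq oU _ (Ck_add oU (cf i) IH)) => p _; rewrite big_cons Pi.
Qed.

Lemma Ck_prod V k (U : set V) (I : Type) (r : seq I) (P : pred I)
    (f : I -> V -> R) :
  open U -> (forall i, Ck k U (f i)) -> Ck k U (fun p => \prod_(i <- r | P i) f i p).
Proof.
move=> oU cf; elim: r => [|i r IH].
  apply: (Ck_eq oU _ (Ck_cst k U (1 : R))) => p _; by rewrite big_nil.
case Pi : (P i); last first.
  by apply: (Ck_eq oU _ IH) => p _; rewrite big_cons Pi.
by apply: (Ck_eq oU _ (Ck_mul oU (cf i) IH)) => p _; rewrite big_cons Pi.
Qed.

(** The derivative of 1 / f is a product of 1 / f and derivatives of f, so the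
    induction on k bootstraps from the class of 1 / f itself; same for the square
    root below. *)
Lemma Ck_inv V k (U : set V) (f : V -> R) : open U ->
  (forall p, U p -> f p != 0) -> Ck k U f -> Ck k U (fun p => (f p)^-1).
Proof.
move=> oU f0; elim: k => [|k IH].
  by move=> cf p Up; apply: continuousV; [exact: f0|exact: cf].
move=> Cf; have [df cf] := Cf; split=> [p Up|v].
  by apply: differentiableV; [exact: df|exact: f0].
have Ci := IH (Ck_pred Cf).
apply: (Ck_eq oU _ (Ck_mul oU (Ck_mul oU (Ck_cst _ _ (-1 : R)) (Ck_mul oU Ci Ci)) (cf v))).
move=> p Up; rewrite deriveV; [|exact: f0|exact/diff_derivable/df].
by rewrite /cst mulN1r -invfM -expr2.
Qed.

Lemma differentiable_sqrt V (f : V -> R) p : 0 < f p -> differentiable f p ->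
  differentiable (fun q => Num.sqrt (f q)) p.
Proof.
move=> fp df; apply: (differentiable_comp df).
by apply/derivable1_diffP; case: (is_derive1_sqrt fp).
Qed.

Lemma derive_sqrt_comp V (f : V -> R) p v : 0 < f p -> differentiable f p ->
  'D_v (fun q => Num.sqrt (f q)) p = (2 * Num.sqrt (f p))^-1 * 'D_v f p.
Proof.
move=> fp df; have ds : differentiable (@Num.sqrt R) (f p).
  by apply/derivable1_diffP; case: (is_derive1_sqrt fp).
rewrite deriveE; last exact: differentiable_sqrt.
rewrite (_ : (fun q => Num.sqrt (f q)) = Num.sqrt \o f) // diff_comp //=.
rewrite deriveE // -[X in 'd _ _ X = _]mulr1.
rewrite -[X in 'd _ _ X = _]/(_ *: 1) linearZ /= mulrC; congr (_ * _).
by rewrite -deriveE //; case: (is_derive1_sqrt fp).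
Qed.

Lemma Ck_sqrt V k (U : set V) (f : V -> R) : open U ->
  (forall p, U p -> 0 < f p) -> Ck k U f -> Ck k U (fun p => Num.sqrt (f p)).
Proof.
move=> oU f0; elim: k => [|k IH].
  move=> cf p Up; apply: continuous_comp; [exact: cf|exact: sqrt_continuous].
move=> Cf; have [df cf] := Cf; split=> [p Up|v].
  by apply: differentiable_sqrt; [exact: f0|exact: df].
have Ci : Ck k U (fun p => (2 * Num.sqrt (f p))^-1).
  apply: Ck_inv => // [p Up|].
    by rewrite mulf_neq0 // gt_eqF // sqrtr_gt0 f0.
  exact: (Ck_mul oU (Ck_cst _ _ (2 : R)) (IH (Ck_pred Cf))).
apply: (Ck_eq oU _ (Ck_mul oU Ci (cf v))) => p Up.
by rewrite derive_sqrt_comp //; [exact: f0|exact: df].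
Qed.

Lemma differentiable_mxP V m n (f : V -> 'M[R]_(m, n)) p :
  differentiable f p <-> forall i j, differentiable (fun q => f q i j) p.
Proof.
split=> [df i j|df]; first exact: (differentiable_comp df (differentiable_coord _ _ _)).
have -> : f = \sum_(i < m) \sum_(j < n) (fun q => f q i j *: delta_mx i j).
  apply/funext => q; rewrite [LHS]matrix_sum_delta fct_sumE.
  by apply: eq_bigr => i _; rewrite fct_sumE.
apply: differentiable_sum => i.
apply: differentiable_sum => j.
exact: (differentiableZl _ (df i j)).
Qed.

Lemma derive_coord V m n (f : V -> 'M[R]_(m, n)) p v i j :
  derivable f p v -> 'D_v (fun q => f q i j) p = ('D_v f p) i j.
Proof. by move=> df; rewrite derive_mx // mxE. Qed.

Lemma Ck_coord V m n k (U : set V) (f : V -> 'M[R]_(m, n)) i j :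
  open U -> Ck k U f -> Ck k U (fun q => f q i j).
Proof.
move=> oU; elim: k f => [|k IH] f /=.
  move=> cf p Up; apply: (@continuous_comp _ _ _ f (fun M => M i j)).
    exact: cf.
  exact: coord_continuous.
move=> [df cf]; split=> [p Up|v]; first exact: (differentiable_mxP _ _).1 (df p Up) i j.
apply: Ck_eq (IH _ (cf v)) => // p Up.
by rewrite derive_coord //; exact/diff_derivable/df.
Qed.

Lemma Ck_mx V m n k (U : set V) (f : V -> 'M[R]_(m, n)) :
  open U -> (forall i j, Ck k U (fun q => f q i j)) -> Ck k U f.
Proof.
move=> oU; elim: k f => [|k IH] f /=.
  move=> cf p Up; apply/cvgrPdist_le => /= e e0.
  near=> x.
  rewrite /Num.Def.normr/= mx_normrE (bigmax_le _ (ltW e0))//= => i _.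
  rewrite !mxE/=.
  move: i; near: x; apply: filter_forall => /= i.
  exact: ((cvgrPdist_le _ _).1 (cf i.1 i.2 p Up)).
move=> cf; have df p : U p -> differentiable f p.
  by move=> Up; apply/differentiable_mxP => i j; exact: (cf i j).1.
split=> // v; apply: IH => i j; apply: Ck_eq ((cf i j).2 v) => // p Up.
by rewrite derive_coord //; exact/diff_derivable/df.
Unshelve. all: by end_near. Qed.

Lemma Ck_det V n k (U : set V) (f : V -> 'M[R]_n) :
  open U -> Ck k U f -> Ck k U (fun q => \det (f q)).
Proof.
move=> oU cf; apply: Ck_sum => // s; apply: (Ck_mul oU (Ck_cst _ _ _)).
by apply: Ck_prod => // i; exact: Ck_coord.
Qed.

Lemma derive_comp_rV n W (f : 'rV[R]_n -> W) V (g : V -> 'rV[R]_n) p v :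
  differentiable g p -> differentiable f (g p) ->
  'D_v (f \o g) p = \sum_(i < n) ('D_v g p) 0 i *: 'D_(delta_mx 0 i) f (g p).
Proof.
move=> dg df; rewrite deriveE; last exact: differentiable_comp.
rewrite diff_comp //= (_ : 'd g p v = 'D_v g p); last by rewrite deriveE.
rewrite [in LHS](row_sum_delta ('D_v g p)) linear_sum.
by apply: eq_bigr => i _; rewrite linearZ /= -(deriveE (delta_mx 0 i) df).
Qed.

(** By the chain rule the partial derivatives of f appear composed with g, and they
    are one class lower: the induction on k is over all f at once. *)
Lemma Ck_comp n V k (A : set V) (U : set 'rV[R]_n)
    (f : 'rV[R]_n -> R) (g : V -> 'rV[R]_n) :
  open A -> open U -> (forall p, A p -> U (g p)) ->
  Ck k A g -> Ck k U f -> Ck k A (f \o g).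
Proof.
move=> oA oU gAU; elim: k f => [|k IH] f.
  move=> cg cf p Ap; apply: continuous_comp; [exact: cg|exact: (cf _ (gAU _ Ap))].
move=> Cg [df cf]; have [dg cg] := Cg; split=> [p Ap|v].
  by apply: differentiable_comp; [exact: dg|exact: (df _ (gAU _ Ap))].
have C : Ck k A (fun p => \sum_(i < n) ('D_v g p) 0 i * ('D_(delta_mx 0 i) f \o g) p).
  apply: Ck_sum => // i; apply: Ck_mul => //; first exact: (Ck_coord _ _ oA (cg v)).
  exact: (IH _ (Ck_pred Cg) (cf _)).
apply: Ck_eq C => // p Ap; rewrite derive_comp_rV //; last first.
- by apply: df; exact: gAU.
- exact: dg.
Qed.

End CkCalculus.

(** * Mean value theorem and symmetry of second derivatives *)

Section MeanValue.
Context {R : realType}.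
Implicit Types V W : normedModType R.

Lemma is_derive_line V W (f : V -> W) p v t :
  derivable f (p + t *: v) v ->
  is_derive t 1 (fun s => f (p + s *: v)) ('D_v f (p + t *: v)).
Proof.
move=> df.
have E : (fun h => h^-1 *: (((fun s => f (p + s *: v)) \o shift t) (h *: (1 : R))
           - f (p + t *: v)))
       = (fun h => h^-1 *: ((f \o shift (p + t *: v)) (h *: v) - f (p + t *: v))).
  apply/funext => h /=; congr (_ *: (f _ - _)).
  by rewrite [h *: 1]mulr1 scalerDl addrCA.
by apply: DeriveDef; rewrite /derivable /derive E.
Qed.

Lemma mean_value_line V (f : V -> R) p v :
  (forall t : R, 0 <= t <= 1 -> differentiable f (p + t *: v)) ->
  exists2 t : R, 0 <= t <= 1 & f (p + v) - f p = 'D_v f (p + t *: v).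
Proof.
move=> df; pose g (s : R) := f (p + s *: v).
have dg (t : R) : 0 <= t <= 1 -> is_derive t 1 g ('D_v f (p + t *: v)).
  by move=> t01; apply: is_derive_line; apply: diff_derivable; exact: df.
have [|| t t01] := @MVT _ g (fun t => 'D_v f (p + t *: v)) 0 1 ltr01.
- by move=> t; rewrite in_itv /= => /andP[t0 t1]; apply: dg; rewrite !ltW.
- apply: continuous_in_subspaceT => t; rewrite inE /= in_itv /= => t01.
  by apply: differentiable_continuous; apply/derivable1_diffP; case: (dg t t01).
rewrite /g scale1r scale0r addr0 subr0 mulr1 => E; exists t => //.
by move: t01; rewrite in_itv /= => /andP[t0 t1]; rewrite !ltW.
Qed.

Lemma derive_scale V W (f : V -> W) p v (c : R) :
  differentiable f p -> 'D_(c *: v) f p = c *: 'D_v f p.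
Proof. by move=> df; rewrite !(deriveE _ df) linearZ. Qed.

Lemma derive_add V W (f : V -> W) p v w :
  differentiable f p -> 'D_(v + w) f p = 'D_v f p + 'D_w f p.
Proof. by move=> df; rewrite !(deriveE _ df) linearD. Qed.

Lemma derive_translate V W (f : V -> W) p v w :
  'D_v (fun q => f (q + w)) p = 'D_v f (p + w).
Proof.
have E : (fun h : R => h^-1 *:
    (((fun q => f (q + w)) \o shift p) (h *: v) - f (p + w))) =
    (fun h : R => h^-1 *: ((f \o shift (p + w)) (h *: v) - f (p + w))).
  by apply/funext => h /=; rewrite addrA.
by rewrite /derive E.
Qed.

Lemma differentiable_translate V W (f : V -> W) p w :
  differentiable f (p + w) -> differentiable (fun q => f (q + w)) p.
Proof.
by move=> df; apply: (@differentiable_comp _ _ _ _ (fun q => q + w) f).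
Qed.

(** The mean value theorem is applied along v to the increment of f in the
    direction w, then along w to the derivative in the direction v. *)
Lemma second_difference V (U : set V) (f : V -> R) p v w :
  Ck 2 U f ->
  (forall a b : R, 0 <= a <= 1 -> 0 <= b <= 1 -> U (p + a *: v + b *: w)) ->
  exists a b : R, [/\ 0 <= a <= 1, 0 <= b <= 1 &
    f (p + v + w) - f (p + v) - f (p + w) + f p =
      'D_w ('D_v f) (p + a *: v + b *: w)].
Proof.
move=> [df ddf] Up.
have i0 : 0 <= (0 : R) <= 1 by rewrite lexx ler01.
have i1 : 0 <= (1 : R) <= 1 by rewrite lexx ler01.
have Ua (a : R) : 0 <= a <= 1 -> U (p + a *: v).
  by move=> ia; have := Up a 0 ia i0; rewrite scale0r addr0.
have Uaw (a : R) : 0 <= a <= 1 -> U (p + a *: v + w).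
  by move=> ia; have := Up a 1 ia i1; rewrite scale1r.
have dF q : U q -> U (q + w) -> differentiable (fun q => f (q + w) - f q) q.
  move=> Uq Uqw; apply: differentiableB; last exact: df.
  by apply: differentiable_translate; exact: df.
have [a ia Ea] := @mean_value_line _ (fun q => f (q + w) - f q) p v
  (fun t it => dF _ (Ua t it) (Uaw t it)).
have [b ib Eb] := @mean_value_line _ ('D_v f) (p + a *: v) w
  (fun t it => (ddf v).1 _ (Up a t ia it)).
exists a, b; split=> //; rewrite -Eb.
transitivity (f (p + v + w) - f (p + v) - (f (p + w) - f p)); first by ring.
rewrite Ea (_ : (fun q => f (q + w) - f q) = (fun q => f (q + w)) - f) //.
rewrite deriveB; first by rewrite derive_translate.
  by apply: diff_derivable; apply: differentiable_translate; exact/df/Uaw.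
by apply: diff_derivable; exact/df/Ua.
Qed.

(** Schwarz: the second difference of f on a small parallelogram is symmetric in its
    sides, and it is s^2 times either mixed derivative at some point of the
    parallelogram; continuity at p makes the two derivatives agree. *)
Lemma derive_commutes V (U : set V) (f : V -> R) p v w :
  open U -> Ck 2 U f -> U p -> 'D_v ('D_w f) p = 'D_w ('D_v f) p.
Proof.
move=> oU cf Up.
suff H (e : R) : 0 < e -> `|'D_v ('D_w f) p - 'D_w ('D_v f) p| <= e.
  apply/eqP; rewrite -subr_eq0 -normr_le0; apply/ler_addgt0Pl => e e0.
  by rewrite addr0 H.
move=> e0.
have [df ddf] := cf.
have c1 : {for p, continuous ('D_v ('D_w f))} by exact: ((ddf w).2 v p Up).
have c2 : {for p, continuous ('D_w ('D_v f))} by exact: ((ddf v).2 w p Up).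
have e2 : 0 < e / 2 by rewrite divr_gt0 // ltr0n.
have n1 : \forall q \near p, `|'D_v ('D_w f) p - 'D_v ('D_w f) q| < e / 2.
  by move/cvgrPdist_lt : c1 => /(_ _ e2).
have n2 : \forall q \near p, `|'D_w ('D_v f) p - 'D_w ('D_v f) q| < e / 2.
  by move/cvgrPdist_lt : c2 => /(_ _ e2).
have n3 : \forall q \near p, U q by exact: (near_open oU Up).
have /nbhs_ballP[r /= r0 rP] : nbhs p (U `&` ([set q |
    `|'D_v ('D_w f) p - 'D_v ('D_w f) q| < e / 2] `&`
    [set q | `|'D_w ('D_v f) p - 'D_w ('D_v f) q| < e / 2])).
  by apply: filterI; [exact: n3|apply: filterI; [exact: n1|exact: n2]].
pose c := `|v| + `|w| + 1; have c0 : 0 < c by rewrite ltr_wpDl // addr_ge0.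
have [s s0 sc] : exists2 s : R, 0 < s & s * c < r.
  exists (r / c / 2); first by rewrite !divr_gt0 // ltr0n.
  by rewrite mulrAC divfK ?gt_eqF // ltr_pdivrMr // ltr_pMr // ltr1n.
have inb (a b : R) : 0 <= a <= 1 -> 0 <= b <= 1 ->
    ball p r (p + a *: (s *: v) + b *: (s *: w)).
  move=> /andP[a0 a1] /andP[b0 b1].
  rewrite -ball_normE /= -addrA opprD addNKr normrN.
  apply: (@le_lt_trans _ _ (s * (`|v| + `|w|))).
    rewrite (le_trans (ler_normD _ _)) // !normrZ.

    rewrite (ger0_norm a0) (ger0_norm b0) (gtr0_norm s0).
    by rewrite mulrDr lerD // ler_piMl // mulr_ge0 // ltW.
  by apply: le_lt_trans sc; rewrite ler_pM2l // /c lerDl.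
have dsv q u x : U q -> 'D_(s *: u) ('D_(s *: x) f) q = s * (s * 'D_u ('D_x f) q).
  move=> Uq.
  have -> : 'D_(s *: u) ('D_(s *: x) f) q = 'D_(s *: u) (s *: 'D_x f) q.
    by apply: near_eq_derive; apply: near_open Uq _ => // y Uy;
      rewrite derive_scale //; exact: df.
  have dx : differentiable ('D_x f) q by exact: (ddf x).1.
  rewrite derive_scale; last exact: differentiableZ.
  have dxu : derivable ('D_x f) q u by exact: diff_derivable.
  by rewrite (deriveZ s dxu).
have [|a [b [ia ib Eab]]] := second_difference cf (p := p) (v := s *: v) (w := s *: w).
  by move=> a b ia ib; case: (rP _ (inb a b ia ib)).
have inb' (a' b' : R) : 0 <= a' <= 1 -> 0 <= b' <= 1 ->
    ball p r (p + a' *: (s *: w) + b' *: (s *: v)).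
  by move=> ia' ib'; rewrite addrAC; exact: inb.
have [|a' [b' [ia' ib' Eab']]] := second_difference cf (p := p) (v := s *: w) (w := s *: v).
  by move=> x y ix iy; case: (rP _ (inb' _ _ ix iy)).
have [U1 [_ h1]] := rP _ (inb a b ia ib).
have [U2 [h2 _]] := rP _ (inb' a' b' ia' ib').
have E : 'D_w ('D_v f) (p + a *: (s *: v) + b *: (s *: w)) =
         'D_v ('D_w f) (p + a' *: (s *: w) + b' *: (s *: v)).
  apply: (mulfI (lt0r_neq0 s0)); apply: (mulfI (lt0r_neq0 s0)).
  apply: (eq_trans (esym (dsv _ w v U1))); apply: (eq_trans (esym Eab)).
  apply: (eq_trans _ (dsv _ v w U2)); apply: (eq_trans _ Eab').
  rewrite (addrAC p (s *: v)); congr (_ + _); exact: addrAC.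
move: h2 => /=; rewrite -E => h2.
apply: le_trans (ler_distD ('D_w ('D_v f) (p + a *: (s *: v) + b *: (s *: w))) _ _) _.
move: h1 => /= h1; rewrite (splitr e); apply: lerD; first exact: ltW h2.
rewrite distrC; exact: ltW h1.
Qed.

Lemma derive_commutes_mx V m n (U : set V) (f : V -> 'M[R]_(m, n)) p v w :
  open U -> Ck 2 U f -> U p -> 'D_v ('D_w f) p = 'D_w ('D_v f) p.
Proof.
move=> oU cf Up; have [df ddf] := cf.
have E u x i j : 'D_u (fun q => 'D_x (fun y => f y i j) q) p = 'D_u ('D_x f) p i j.
  rewrite -derive_coord; last exact/diff_derivable/(ddf x).1.
  apply: near_eq_derive; apply: near_open Up _ => // q Uq.
  by rewrite derive_coord //; exact/diff_derivable/df.
apply/matrixP => i j.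
apply: (eq_trans (esym (E v w i j))); apply: (eq_trans _ (E w v i j)).
exact: (derive_commutes _ _ oU (Ck_coord i j oU cf)).
Qed.

Lemma coord_le_norm m n (A : 'M[R]_(m, n)) i j : `|A i j| <= `|A|.
Proof.
rewrite [leRHS]/Num.Def.normr /= mx_normrE.
exact: (le_bigmax _ (fun ij => `|A ij.1 ij.2|) (i, j)).
Qed.

Lemma norm_le_coord m n (A : 'M[R]_(m, n)) (c : R) : 0 <= c ->
  (forall i j, `|A i j| <= c) -> `|A| <= c.
Proof.
by move=> c0 Ac; rewrite /Num.Def.normr /= mx_normrE bigmax_le // => -[i j].
Qed.

(** With the max norm, the inequality reduces to the mean value theorem for each
    entry. *)
Lemma mean_value_inequality V m n (f : V -> 'M[R]_(m, n)) p v (c : R) : 0 <= c ->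
  (forall t : R, 0 <= t <= 1 ->
    differentiable f (p + t *: v) /\ `|'D_v f (p + t *: v)| <= c) ->
  `|f (p + v) - f p| <= c.
Proof.
move=> c0 fc; apply: norm_le_coord => // i j.
have [|t it] := @mean_value_line _ (fun q => f q i j) p v.
  by move=> t it; exact: (differentiable_mxP _ _).1 (fc t it).1 i j.
rewrite !mxE => ->; rewrite derive_coord; last exact/diff_derivable/(fc t it).1.
exact: le_trans (coord_le_norm _ _ _) (fc t it).2.
Qed.

Lemma diff_small V W (f : V -> W) p (e : R) : differentiable f p -> 0 < e ->
  \forall h \near (0 : V), `|f (p + h) - f p - 'D_h f p| <= e * `|h|.
Proof.
move=> df e0; have /diff_locallyP[_ /eqaddoP /(_ e e0)] := df.
by apply: filterS => h /=; rewrite !fctE /= opprD addrA (addrC h) -deriveE.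
Qed.

(** An epsilon form of differentiability, which produces the differential together
    with its value. *)
Lemma diff_small_unique V W (f : V -> W) p (L : {linear V -> W}) :
  continuous L ->
  (forall e : R, 0 < e ->
    \forall h \near (0 : V), `|f (p + h) - f p - L h| <= e * `|h|) ->
  differentiable f p /\ forall h, 'D_h f p = L h.
Proof.
move=> cL fL.
have E : f \o shift p = cst (f p) + L +o_ 0 id.
  apply/eqaddoP => e e0; have := fL e e0.
  by apply: filterS => h /=; rewrite !fctE /= opprD addrA (addrC h).
have dL := diff_unique cL E.
have df : differentiable f p by apply/diff_locallyP; rewrite dL.
by split=> // h; rewrite deriveE // dL.
Qed.

End MeanValue.

(** * Local bounds for derivatives *)

HB.instance Definition _ (R : realType) (m n : nat) := Complete.on 'M[R]_(m, n).

Section InverseFunction.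
Context {R : realType}.
Implicit Types V W : normedModType R.

Lemma Ck_id V k (U : set V) : Ck k U (id : V -> V).
Proof.
case: k => [|k] /=; first by move=> p _; exact: cvg_id.
split=> // v; rewrite (_ : 'D_v id = cst v); first exact: Ck_cst.
by apply/funext => p; rewrite derive_id.
Qed.

Lemma Ck_mulmxr V l m n k (U : set V) (f : V -> 'M[R]_(l, m)) (M : 'M[R]_(m, n)) :
  open U -> Ck k U f -> Ck k U (fun p => f p *m M).
Proof.
move=> oU cf; apply: Ck_mx => // i j.
have C : Ck k U (fun p => \sum_(a < m) f p i a * M a j).
  by apply: Ck_sum => // a; apply: (Ck_mul oU (Ck_coord i a oU cf)); exact: Ck_cst.
by apply: Ck_eq C => // p _; rewrite mxE.
Qed.

Lemma continuous_mulmxr l m n (M : 'M[R]_(m, n)) :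
  continuous (mulmxr M : 'M[R]_(l, m) -> 'M[R]_(l, n)).
Proof.
move=> A; have := Ck_mulmxr (k := 0) M openT (Ck_id 0 [set: 'M[R]_(l, m)]).
by move=> /(_ A I).
Qed.

Lemma derive_mulmxr V l m n (f : V -> 'M[R]_(l, m)) (M : 'M[R]_(m, n)) p v :
  differentiable f p -> 'D_v (fun q => f q *m M) p = 'D_v f p *m M.
Proof.
move=> df; have cM := @continuous_mulmxr l m n M.
have dM : differentiable (mulmxr M) (f p) by exact: linear_differentiable.
rewrite (deriveE _ (differentiable_comp df dM)) (diff_comp df dM) /=.
by rewrite (diff_lin _ cM) /= (deriveE _ df).
Qed.

Lemma differentiable_mulmxr V l m n (f : V -> 'M[R]_(l, m)) (M : 'M[R]_(m, n)) p :
  differentiable f p -> differentiable (fun q => f q *m M) p.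
Proof.
move=> df; have dM : differentiable (mulmxr M) (f p).
  exact/linear_differentiable/continuous_mulmxr.
exact: (differentiable_comp df dM).
Qed.

(** The sum of the norms of the partial derivatives is a continuous function that
    bounds every directional derivative; the constant is kept explicit because the
    inverse function theorem needs it to be small where the derivative vanishes. *)
Lemma near_derive_bound n W (U : set 'rV[R]_n) (g : 'rV[R]_n -> W) p0 (e : R) :
  open U -> Ck 1 U g -> U p0 -> 0 < e ->
  exists2 r : R, 0 < r & forall p, `|p - p0| <= r -> U p /\
    forall v, `|'D_v g p| <= (\sum_(i < n) `|'D_(delta_mx 0 i) g p0| + e) * `|v|.
Proof.
move=> oU [dg cg] Up0 e0.
pose s p := \sum_(i < n) `|'D_(delta_mx 0 i) g p|; rewrite -/(s p0).
have cs : {for p0, continuous s}.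
  have c i : Ck 0 U (fun p => `|'D_(delta_mx 0 i) g p|).
    move=> p Up; apply: (@continuous_comp _ _ _ ('D_(delta_mx 0 i) g) Num.norm).
      exact: cg.
    exact: norm_continuous.
  exact: (Ck_sum (index_enum 'I_n) xpredT oU c p0 Up0).
have n1 : \forall p \near p0, `|s p0 - s p| < e.
  by move/cvgrPdist_lt : cs => /(_ _ e0).
have n2 : \forall p \near p0, U p by exact: (near_open oU Up0).
have /nbhs_ballP[r /= r0 rP] : nbhs p0 (U `&` [set p | `|s p0 - s p| < e]).
  by apply: filterI; [exact: n2|exact: n1].
exists (r / 2); first by rewrite divr_gt0 // ltr0n.
move=> p pr; have /rP[Up /= sp] : ball p0 r p.
  rewrite -ball_normE /= distrC; apply: le_lt_trans pr _.
  by rewrite ltr_pdivrMr ?ltr0n // ltr_pMr // ltr1n.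
split=> // v; rewrite (deriveE _ (dg _ Up)) [X in 'd g p X](row_sum_delta v) linear_sum.
apply: (@le_trans _ _ (\sum_(i < n) `|v| * `|'D_(delta_mx 0 i) g p|)).
  apply: le_trans (ler_norm_sum _ _ _) _; apply: ler_sum => i _.
  rewrite linearZ /= normrZ -(deriveE _ (dg _ Up)) ler_wpM2r //.
  exact: coord_le_norm.
rewrite -mulr_sumr mulrC ler_wpM2r // -/(s p).
by move: sp; rewrite ltr_norml => /andP[sp _]; rewrite ltW // -ltrBlDl -opprB ltrNl.
Qed.

Lemma segment_in_ball V p0 p k (r t : R) : `|p - p0| <= r ->
  `|p + k - p0| <= r -> 0 <= t <= 1 -> `|(p : V) + t *: k - p0| <= r.
Proof.
move=> pr pkr /andP[t0 t1].
have -> : p + t *: k - p0 = (1 - t) *: (p - p0) + t *: (p + k - p0).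
  rewrite scalerBl scale1r -[RHS]addrA [- _ + _]addrC -scalerBr.
  have -> : p + k - p0 - (p - p0) = k.
    by rewrite opprB addrA subrK addrAC subrr add0r.
  exact: addrAC.
rewrite (le_trans (ler_normD _ _)) // !normrZ (ger0_norm t0) ger0_norm ?subr_ge0 //.
apply: (@le_trans _ _ ((1 - t) * r + t * r)); last by rewrite -mulrDl subrK mul1r.
by apply: lerD; apply: ler_wpM2l; rewrite ?subr_ge0.
Qed.

Lemma derive_bound_lipschitz V m n (g : V -> 'M[R]_(m, n)) p0 (r c : R) : 0 <= c ->
  (forall p, `|p - p0| <= r ->
     differentiable g p /\ forall v, `|'D_v g p| <= c * `|v|) ->
  forall p p', `|p - p0| <= r -> `|p' - p0| <= r ->
    `|g p' - g p| <= c * `|p' - p|.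
Proof.
move=> c0 gr p p' pr p'r.
rewrite -{1}(subrKC p p'); apply: mean_value_inequality; first by rewrite mulr_ge0.
move=> t /andP[t0 t1].
have tr : `|p + t *: (p' - p) - p0| <= r.
  by apply: segment_in_ball; rewrite ?subrKC ?t0.
have [dg gv] := gr _ tr; split=> //; exact: gv.
Qed.

End InverseFunction.

(** * Inverse function theorem *)

(** By Cramer's rule the entries of the inverse are quotients of minors by the
    determinant. *)
Lemma Ck_invmx {R : realType} n (V : normedModType R) k (U : set V) (A : V -> 'M[R]_n) :
  open U -> (forall p, U p -> A p \in unitmx) -> Ck k U A ->
  Ck k U (fun p => invmx (A p)).
Proof.
move=> oU uA cA; apply: Ck_mx => // i j.
have C : Ck k U (fun p => (\det (A p))^-1 *
    ((-1) ^+ (j + i) * \det (row' j (col' i (A p))))).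
  apply: (Ck_mul oU).
    apply: Ck_inv => //; last exact: Ck_det.
    by move=> p /uA; rewrite unitmxE unitfE.
  apply: (Ck_mul oU); first exact: Ck_cst.
  apply: Ck_det => //; apply: Ck_mx => // a b.
  apply: (Ck_eq oU _ (Ck_coord (lift j a) (lift i b) oU cA)) => p _.
  by rewrite !mxE.
apply: (Ck_eq oU _ C) => p Up; rewrite /invmx (uA p Up) mxE /adjugate mxE.
by [].
Qed.

Section SmoothInverse.
Context {R : realType} {n : nat}.
Implicit Types (f g : 'rV[R]_n -> 'rV[R]_n) (p q v : 'rV[R]_n).

(** A half-contraction that moves the centre by less than r / 2 maps the closed ball
    into the open one, so Banach's fixed point lies in the open ball. *)
Lemma closed_ball_fixed_point g p0 (r : R) : 0 < r ->
  (forall p p', `|p - p0| <= r -> `|p' - p0| <= r ->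
     `|g p' - g p| <= 2^-1 * `|p' - p|) ->
  `|g p0 - p0| < r / 2 ->
  exists2 p, `|p - p0| < r & g p = p.
Proof.
move=> r0 gL g0.
have stay p : `|p - p0| <= r -> `|g p - p0| < r.
  move=> pr; rewrite -(subrKA (g p0)); apply: le_lt_trans (ler_normD _ _) _.
  rewrite [ltRHS]splitr; apply: ler_ltD => //.
  apply: le_trans (gL _ _ _ pr) _; first by rewrite subrr normr0 ltW.
  by rewrite mulrC ler_wpM2r // invr_ge0 ler0n.
pose A : set 'rV[R]_n := closed_ball p0 r.
have AE p : A p <-> `|p - p0| <= r.
  by rewrite /A closed_ballE // /closed_ball_ /= distrC.
have gA : set_fun A A g by move=> p /AE/stay/ltW/AE.
pose gM := isFun.Build _ _ A A g gA.
pose gF : {fun A >-> A} := HB.pack g gM.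
have gC : is_contraction gF.
  have i2 : 0 <= 2^-1 :> R by rewrite invr_ge0 ler0n.
  exists (NngNum i2); split; first by rewrite /= invf_lt1 ?ltr0n // ltr1n.
  by move=> [p p'] /= [Ap Ap']; apply: gL; apply/AE.
have cA : closed A by exact: closed_ball_closed.
have [|p Ap Ep] := banach_fixed_point gC cA.
  by exists p0; apply/AE; rewrite subrr normr0 ltW.
exists p; last by rewrite [RHS]Ep.
by rewrite [p in `|p - _|]Ep; apply: stay; apply/AE.
Qed.

Section Construction.
Variables (U : set 'rV[R]_n) (f : 'rV[R]_n -> 'rV[R]_n) (p0 : 'rV[R]_n).
Hypotheses (oU : open U) (sf : smooth U f) (Up0 : U p0).
Hypothesis Jf : 'J f p0 \in unitmx.

Let B := invmx ('J f p0).
Let g p := p - f p *m B.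

Let df p : U p -> differentiable f p.
Proof. by case: (sf 1) => + _; apply. Qed.

Let dg p v : U p -> differentiable g p /\ 'D_v g p = v - 'D_v f p *m B.
Proof.
move=> Up; have dfB := differentiable_mulmxr B (df Up).
have dg : differentiable g p by exact: differentiableB.
split=> //; rewrite /g (_ : (fun q => _) = id - (fun q => f q *m B)) //.
rewrite deriveB; [|exact: derivable_id|exact: diff_derivable].
by rewrite derive_id derive_mulmxr //; exact: df.
Qed.

Let BJ v : v *m 'J f p0 *m B = v.
Proof. by rewrite -mulmxA mulmxV // mulmx1. Qed.

Let Binj v : v *m B = 0 -> v = 0.
Proof. by move=> vB; rewrite -[v]mulmx1 -(mulVmx Jf) mulmxA vB mul0mx. Qed.

Let Cg : Ck 1 U g.
Proof.
have C := Ck_mulmxr (- B) oU (sf 1).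
apply: (Ck_eq oU _ (Ck_add oU (Ck_id 1 U) C)) => p _.
by rewrite mulmxN.
Qed.

(** Normalized by B, the inverse of the Jacobian at p0, f becomes the identity
    minus a map g whose derivative vanishes at p0. Near p0 the map g is a
    half-contraction, so f p = q is the fixed point equation p = g p + q B, and
    the inverse is Lipschitz for the norm of q B. *)
Lemma quantitative_local_inverse : exists (r : R) (phi : 'rV[R]_n -> 'rV[R]_n),
  [/\ 0 < r,
      forall p, `|p - p0| < r -> U p /\ 'J f p \in unitmx,
      forall q, `|(q - f p0) *m B| < r / 2 -> `|phi q - p0| < r /\ f (phi q) = q &
      forall p p', `|p - p0| < r -> `|p' - p0| < r ->
        `|p' - p| <= 2 * `|(f p' - f p) *m B|].
Proof.
have h0 : 0 < 2^-1 :> R by rewrite invr_gt0 ltr0n.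
have [r r0] := near_derive_bound oU Cg Up0 h0.
rewrite big1 => [|i _]; last first.
  have [_ ->] := dg (delta_mx 0 i) Up0.
  by rewrite (deriveEjacobian _ (df Up0)) BJ subrr normr0.
rewrite add0r => rP.
have gL := @derive_bound_lipschitz _ _ _ _ g p0 r 2^-1.
have {}gL p p' : `|p - p0| <= r -> `|p' - p0| <= r ->
    `|g p' - g p| <= 2^-1 * `|p' - p|.
  apply: gL; first by rewrite invr_ge0 ler0n.
  by move=> x xr; have [Ux gx] := rP x xr; split=> //; case: (dg 0 Ux).
have ex q : exists p, `|(q - f p0) *m B| < r / 2 -> `|p - p0| < r /\ f p = q.
  have [qr|] := pselect (`|(q - f p0) *m B| < r / 2); last by exists p0.
  have [||p pr Ep] := @closed_ball_fixed_point (fun p => g p + q *m B) p0 r r0.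
  - by move=> p p' pr p'r; rewrite opprD addrACA subrr addr0; exact: gL.
  - rewrite /g (_ : p0 - f p0 *m B + q *m B - p0 = (q - f p0) *m B) //.
    by rewrite mulmxBl addrAC [p0 - _ - p0]addrAC subrr add0r addrC.
  exists p => _; split=> //.
  apply/eqP; rewrite eq_sym -subr_eq0; apply/eqP/Binj.
  rewrite mulmxBl; move: Ep; rewrite /g -addrA => /(congr1 (fun x => x - p)).
  by rewrite /= addrAC subrr add0r addrC.
have [phi phiP] := choice ex.
exists r, phi; split; first exact: r0.
- move=> p pr; have [Up gp] := rP p (ltW pr); split; first exact: Up.
  rewrite -row_free_unit; apply: inj_row_free => v vJ.
  have := gp v; have [_ ->] := dg v Up.
  rewrite (deriveEjacobian _ (df Up)) vJ mul0mx subr0 => h.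
  apply/eqP; rewrite -normr_le0 leNgt; apply/negP => v0.
  move: h; rewrite leNgt => /negP; apply.
  by rewrite gtr_pMl // invf_lt1 ?ltr0n // ltr1n.
- by move=> q; have := phiP q; exact.
(* Since p' - p = (g p' - g p) + (f p' - f p) B, the contraction estimate for g
   bounds |p' - p| by twice the last term. *)
move=> p p' pr p'r; have := gL p p' (ltW pr) (ltW p'r).
have -> : g p' - g p = (p' - p) - (f p' - f p) *m B.
  rewrite /g mulmxBl [in LHS]opprD opprK addrACA opprB.
  by congr (_ + _); exact: addrC.
set y := (f p' - f p) *m B => h.
have h2 : `|p' - p| <= 2^-1 * `|p' - p| + `|y|.
  rewrite -{1}(subrK y (p' - p)); apply: le_trans (ler_normD _ _) _.
  by rewrite lerD2r.
move: h2; move: `|p' - p| `|y| => a b; lra.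
Qed.

End Construction.
End SmoothInverse.

Section InverseFunctionTheorem.
Context {R : realType} {n : nat}.
Implicit Types (f : 'rV[R]_n -> 'rV[R]_n) (p q v : 'rV[R]_n).

Lemma mulmxr_bound m l k (M : 'M[R]_(m, k)) :
  exists2 c : R, 0 < c & forall v : 'M[R]_(l, m), `|v *m M| <= c * `|v|.
Proof.
by have [c c0 h] := linear_lipschitz (@continuous_mulmxr R l m k M); exists c.
Qed.

(** With k = phi (q + h) - phi q one has h = k J + o(k), so k - h J^-1 = o(k), and
    o(k) = o(h) by the Lipschitz bound on phi. *)
Lemma derive_inverse f phi q (c : R) :
  differentiable f (phi q) -> 'J f (phi q) \in unitmx -> 0 < c ->
  (\forall h \near (0 : 'rV[R]_n),
     f (phi (q + h)) = q + h /\ `|phi (q + h) - phi q| <= c * `|h|) ->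
  differentiable phi q /\
  forall v, 'D_v phi q = v *m invmx ('J f (phi q)).
Proof.
move=> df uJ c0 near_h; set J := 'J f (phi q).
apply: (diff_small_unique (L := mulmxr (invmx J))).
  exact: continuous_mulmxr.
move=> e e0 /=.
have [d d0 dM] := mulmxr_bound 1 (invmx J).
(* d bounds the inverse Jacobian and c is the Lipschitz constant of phi. *)
have e'0 : 0 < e / (d * c) by rewrite divr_gt0 // mulr_gt0.
have [s /= s0 sP] := (nbhs_ballP _ _).1 (diff_small df e'0).
have [t /= t0 tP] := (nbhs_ballP _ _).1 near_h.
have fq : f (phi q) = q.
  by have [] := tP 0 (ballxx _ t0); rewrite addr0.
apply/nbhs_ballP; exists (Num.min t (s / c)) => /=.
  by rewrite lt_min t0 divr_gt0.
move=> h; rewrite -ball_normE /= sub0r normrN lt_min => /andP[ht hs].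
have [|fh kh] := tP h; first by rewrite -ball_normE /= sub0r normrN.
set k := phi (q + h) - phi q in kh *.
have ks : ball 0 s k.
  rewrite -ball_normE /= sub0r normrN; apply: le_lt_trans kh _.
  by rewrite mulrC -ltr_pdivlMr.
have /= := sP k ks.
rewrite (deriveEjacobian _ df) -/J /k subrKC fh fq -/k => small.
have E : k - h *m invmx J = - ((q + h - q - k *m J) *m invmx J).
  by rewrite mulmxBl mulmxK // [q + h]addrC addrK opprB.
rewrite E normrN; apply: le_trans (dM _) _.
apply: (@le_trans _ _ (d * (e / (d * c) * (c * `|h|)))).
  rewrite ler_pM2l //; apply: le_trans small _.
  by rewrite ler_pM2l.
rewrite le_eqVlt; apply/orP; left; apply/eqP.
by field; rewrite !gt_eqF.
Qed.

(** Bootstrap: the derivative of phi is the inverse Jacobian of f composed with phi,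
    so phi of class C^k has derivatives of class C^k. *)
Lemma smooth_inverse (V U : set 'rV[R]_n) f phi :
  open V -> open U -> smooth U f -> (forall q, V q -> U (phi q)) ->
  (forall q, V q -> 'J f (phi q) \in unitmx) ->
  (forall q, V q -> differentiable phi q) ->
  (forall q v, V q -> 'D_v phi q = v *m invmx ('J f (phi q))) ->
  smooth V phi.
Proof.
move=> oV oU sf VU uJ dphi Dphi; elim=> [|k IH].
  by move=> q Vq; apply: differentiable_continuous; exact: dphi.
split=> // v.
have df p : U p -> differentiable f p by exact: (sf 1).1.
have CJ : Ck k V (fun q => 'J f (phi q)).
  apply: Ck_mx => // i j.
  have C := Ck_comp oV oU VU IH (Ck_coord 0 j oU ((sf k.+1).2 (delta_mx 0 i))).
  apply: (Ck_eq oV _ C) => q Vq /=.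
  by rewrite (deriveEjacobian _ (df _ (VU _ Vq))) -rowE mxE.
have CI := Ck_invmx oV uJ CJ.
apply: Ck_mx => // i j.
have C : Ck k V (fun q => \sum_(a < n) v i a * invmx ('J f (phi q)) a j).
  apply: Ck_sum => // a; apply: (Ck_mul oV); first exact: Ck_cst.
  exact: (Ck_coord a j oV CI).
by apply: (Ck_eq oV _ C) => q Vq; rewrite (Dphi q v Vq) mxE.
Qed.

Theorem inverse_function_theorem (U : set 'rV[R]_n) f p0 :
  open U -> smooth U f -> U p0 -> 'J f p0 \in unitmx ->
  exists (V W : set 'rV[R]_n) (phi : 'rV[R]_n -> 'rV[R]_n),
    [/\ W p0, W `<=` U, diffeomorphism V W phi & forall q, V q -> f (phi q) = q].
Proof.
move=> oU sf Up0 uJ.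
have [r [phi [r0 rU rV rL]]] := quantitative_local_inverse oU sf Up0 uJ.
set B := invmx ('J f p0) in rV rL.
have h2 : 0 < r / 2 by rewrite divr_gt0 // ltr0n.
pose W0 : set 'rV[R]_n := ball p0 r.
have W0E p : W0 p <-> `|p - p0| < r by rewrite /W0 -ball_normE /= distrC.
pose V : set 'rV[R]_n := [set q | ball 0 (r / 2) ((q - f p0) *m B)].
have VE q : V q <-> `|(q - f p0) *m B| < r / 2.
  by rewrite /V /= -ball_normE /= sub0r normrN.
have oW0 : open W0 by exact: ball_open.
have oV : open V.
  have C : Ck 0 setT (fun q => (q - f p0) *m B).
    apply: (Ck_mulmxr B openT); apply: (Ck_add openT (Ck_id 0 setT)).
    exact: Ck_cst.
  apply: (open_comp (f := fun q => (q - f p0) *m B)); last exact: ball_open.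
  by move=> q _; exact: C.
pose W : set 'rV[R]_n := W0 `&` f @^-1` V.
have WU p : W0 p -> U p by move=> /W0E/rU[].
have cf p : W0 p -> {for p, continuous f}.
  by move=> /WU Up; apply: differentiable_continuous; exact: (sf 1).1.
have oW : open W.
  rewrite openE => p [W0p Vp]; apply: filterI.
    exact: (near_open oW0 W0p).
  by apply: (cf p W0p); exact: open_nbhs_nbhs.
have phiV q : V q -> W0 (phi q) /\ f (phi q) = q.
  by move=> /VE /rV[/W0E].
have phiW q : V q -> W (phi q).
  by move=> Vq; have [W0q fq] := phiV q Vq; split=> //; rewrite /= fq.
have Lip q q' : V q -> V q' -> `|phi q' - phi q| <= 2 * `|(q' - q) *m B|.
  move=> /phiV[/W0E Wq fq] /phiV[/W0E Wq' fq'].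
  by have := rL _ _ Wq Wq'; rewrite fq fq'.
have [d d0 dM] := mulmxr_bound 1 B.
have der q : V q -> differentiable phi q /\
    forall v, 'D_v phi q = v *m invmx ('J f (phi q)).
  move=> Vq; have [W0q fq] := phiV q Vq.
  apply: (derive_inverse (c := 2 * d)).
  - exact/(sf 1).1/WU.
  - by case: (rU (phi q)); first exact/W0E.
  - by rewrite mulr_gt0 // ltr0n.
  have : nbhs q V by exact: open_nbhs_nbhs.
  move=> /nbhs_ballP[t /= t0 tV]; apply/nbhs_ballP; exists t => //= h ht.
  have Vqh : V (q + h).
    apply: tV; move: ht; rewrite -!ball_normE /= sub0r.
    by rewrite opprD addNKr.
  have [_ fqh] := phiV _ Vqh; split=> //.
  have := Lip _ _ Vq Vqh; rewrite [q + h]addrC addrK [h + q]addrC => h3.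
  by apply: le_trans h3 _; rewrite -mulrA ler_pM2l ?ltr0n.
exists V, W, phi; split.
- split; first by apply/W0E; rewrite subrr normr0.
  by apply/VE; rewrite subrr mul0mx normr0.
- by move=> p [/WU].
- split=> //.
    apply: (smooth_inverse oV oU sf).
    + by move=> q /phiV[/WU].
    + by move=> q /phiV[/W0E/rU[]].
    + by move=> q /der[].
    + by move=> q v /der[].
  exists f; split=> //.
  + by move=> k; apply: Ck_subset (sf k) => p [/WU].
  + by move=> p [].
  + by move=> q /phiV[].
  + move=> p [W0p Vp]; have [W0' ff] := phiV _ Vp.
    have := rL _ _ ((W0E _).1 W0p) ((W0E _).1 W0').
    rewrite ff subrr mul0mx normr0 mulr0 normr_le0 subr_eq0.
    by move=> /eqP.
- by move=> q /phiV[].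
Qed.

End InverseFunctionTheorem.

(** * The Poincare lemma *)

Section Poincare.
Context {R : realType}.

Lemma continuous_primitive (f : R -> R) (a b : R) : a < b ->
  (forall x, a <= x <= b -> {for x, continuous f}) ->
  exists F : R -> R, {within `[a, b], continuous F} /\
    forall x, a < x < b -> is_derive x 1 F (f x).
Proof.
move=> ab cf.
have fi : lebesgue_measure.-integrable `[a, b] (EFin \o f).
  apply: continuous_compact_integrable; first exact: segment_compact.
  by apply: continuous_in_subspaceT => x; rewrite inE /= in_itv /=; exact: cf.
exists (fun x => parameterized_integral lebesgue_measure a x f); split.
  exact: parameterized_integral_continuous (ltW ab) fi.
move=> x /andP[ax xb].
have cx : {for x, continuous f} by apply: cf; rewrite !ltW.
have [dF EF] := continuous_FTC1_closed xb fi ax cx.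
by apply: DeriveDef; [exact: dF|rewrite -derive1E].
Qed.

Lemma norm_mulmx l m n (A : 'M[R]_(l, m)) (B : 'M[R]_(m, n)) :
  `|A *m B| <= m%:R * (`|A| * `|B|).
Proof.
apply: norm_le_coord => [|i j]; first by rewrite !mulr_ge0.
rewrite mxE; apply: le_trans (ler_norm_sum _ _ _) _.
rewrite -[m in m%:R]card_ord mulr_natl -sumr_const; apply: ler_sum => k _.
by rewrite normrM ler_pM // coord_le_norm.
Qed.

Lemma norm_trmx m n (A : 'M[R]_(m, n)) : `|A^T| <= `|A|.
Proof. by apply: norm_le_coord => // i j; rewrite mxE coord_le_norm. Qed.

Variable n : nat.
Implicit Types (a : 'rV[R]_n -> 'rV[R]_n) (p h k u v : 'rV[R]_n).

(** The value on the vector v of the 1-form with coefficients u. *)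
Definition pairing u v : R := (u *m v^T) 0 0.

Lemma pairingE u v : pairing u v = \sum_(i < n) u 0 i * v 0 i.
Proof. by rewrite /pairing mxE; apply: eq_bigr => i _; rewrite mxE. Qed.

Lemma norm_pairing u v : `|pairing u v| <= n%:R * (`|u| * `|v|).
Proof.
apply: le_trans (coord_le_norm _ _ _) _; apply: le_trans (norm_mulmx _ _) _.
by rewrite ler_wpM2l // ler_wpM2l // norm_trmx.
Qed.

Lemma Ck_jacobian (U : set 'rV[R]_n) a (k : nat) :
  open U -> Ck k.+1 U a -> Ck k U (jacobian a).
Proof.
move=> oU [da ca]; apply: Ck_mx => // i j.
apply: (Ck_eq oU _ (Ck_coord 0 j oU (ca (delta_mx 0 i)))) => p Up.
by rewrite (deriveEjacobian _ (da _ Up)) -rowE mxE.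
Qed.

Lemma derive_pairing a p v k : differentiable a p ->
  derivable (fun q => pairing (a q) k) p v /\
  'D_v (fun q => pairing (a q) k) p = pairing ('D_v a p) k.
Proof.
move=> da; have d := differentiable_mulmxr k^T da.
have E := derive_mulmxr k^T v da.
have dv := diff_derivable (v := v) d.
split; first exact: (derivable_mxP _ _ _).1 dv 0 0.
by rewrite /pairing -E -derive_coord.
Qed.

(** Taylor's formula at order one with uniform constants: the mean value inequality
    for q |-> a q - q J(p), whose derivative along k is k (J(q) - J(p)). *)
Lemma second_order_estimate (U : set 'rV[R]_n) a p0 :
  open U -> Ck 2 U a -> U p0 ->
  exists r M : R, [/\ 0 < r, 0 <= M,
    forall p, `|p - p0| <= r -> U p &
    forall p k, `|p - p0| <= r -> `|p + k - p0| <= r ->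
      `|a (p + k) - a p| <= M * `|k| /\
      `|a (p + k) - a p - k *m 'J a p| <= M * `|k| ^+ 2].
Proof.
move=> oU ca Up0.
have da p : U p -> differentiable a p by exact: ca.1.
have bound (W : normedModType R) (g : 'rV[R]_n -> W) : Ck 1 U g -> exists r M : R,
    [/\ 0 < r, 0 <= M & forall p, `|p - p0| <= r ->
      U p /\ forall v, `|'D_v g p| <= M * `|v|].
  move=> cg; have [r r0 h] := near_derive_bound oU cg Up0 ltr01.
  by exists r; eexists; split; [exact: r0| |exact: h]; rewrite addr_ge0 ?sumr_ge0.
have [r1 [M1 [r10 M10 h1]]] := bound _ _ (Ck_pred ca).
have [r2 [M2 [r20 M20 h2]]] := bound _ _ (Ck_jacobian oU ca).
pose r := Num.min r1 r2.
have r0 : 0 < r by rewrite lt_min r10.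
have le1 (x : R) : x <= r -> x <= r1 by rewrite le_min => /andP[].
have le2 (x : R) : x <= r -> x <= r2 by rewrite le_min => /andP[].
have UP p : `|p - p0| <= r -> U p by move=> /le1/h1[].
have La p p' : `|p - p0| <= r -> `|p' - p0| <= r -> `|a p' - a p| <= M1 * `|p' - p|.
  apply: derive_bound_lipschitz => // q qr; split; first exact/da/UP.
  by have [_] := h1 q (le1 _ qr).
have LJ p p' : `|p - p0| <= r -> `|p' - p0| <= r ->
    `|'J a p' - 'J a p| <= M2 * `|p' - p|.
  apply: derive_bound_lipschitz => // q qr; split.
    by apply: (Ck_jacobian oU ca).1; exact: UP.
  by have [_] := h2 q (le2 _ qr).
exists r, (M1 + n%:R * M2); split=> //; first by rewrite addr_ge0 // mulr_ge0.
move=> p k pr pkr; split.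
  have := La p (p + k) pr pkr; rewrite [p + k]addrC addrK [k + p]addrC => h.
  by apply: le_trans h _; rewrite ler_wpM2r // lerDl mulr_ge0.
have -> : a (p + k) - a p - k *m 'J a p =
    (a (p + k) - (p + k) *m 'J a p) - (a p - p *m 'J a p).
  rewrite mulmxDl; move: (a (p + k)) (a p) (p *m _) (k *m _) => A B C D.
  by apply/rowP => i; rewrite !mxE; ring.
pose u q := a q - q *m 'J a p.
rewrite -/(u (p + k)) -/(u p).
apply: (@mean_value_inequality _ _ _ _ u).
  by rewrite mulr_ge0 ?exprn_ge0 // addr_ge0 // mulr_ge0.
move=> t t01; set q := p + t *: k.
have qr : `|q - p0| <= r by exact: segment_in_ball.
have dq := da _ (UP _ qr).
have di : differentiable (fun x : 'rV[R]_n => x *m 'J a p) q.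
  exact: differentiable_mulmxr.
have du : differentiable u q by exact: differentiableB.
split=> //.
rewrite /u (_ : (fun q => _) = a - (fun x => x *m 'J a p)) //.
rewrite (deriveB (diff_derivable (v := k) dq) (diff_derivable (v := k) di)).
rewrite (deriveEjacobian _ dq) (derive_mulmxr _ _ (f := id)) // derive_id -mulmxBr.
apply: le_trans (norm_mulmx _ _) _.
have [t0 t1] := andP t01.
have h : `|'J a q - 'J a p| <= M2 * `|k|.
  apply: le_trans (LJ _ _ pr qr) _; rewrite ler_wpM2l //.
  by rewrite /q [p + _]addrC addrK normrZ ger0_norm // ler_piMl.
apply: (@le_trans _ _ (n%:R * (`|k| * (M2 * `|k|)))).
  by rewrite ler_wpM2l // ler_wpM2l.
rewrite (_ : n%:R * (`|k| * (M2 * `|k|)) = n%:R * M2 * `|k| ^+ 2); last by ring.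
by rewrite ler_wpM2r ?exprn_ge0 // lerDr.
Qed.

Lemma pairingC u v : pairing u v = pairing v u.
Proof. by rewrite !pairingE; apply: eq_bigr => i _; rewrite mulrC. Qed.

Lemma pairingDl u1 u2 v : pairing (u1 + u2) v = pairing u1 v + pairing u2 v.
Proof. by rewrite /pairing mulmxDl mxE. Qed.

Lemma pairingBl u1 u2 v : pairing (u1 - u2) v = pairing u1 v - pairing u2 v.
Proof. by rewrite /pairing mulmxBl mxE [X in _ + X]mxE. Qed.

Lemma pairingZl (c : R) u v : pairing (c *: u) v = c * pairing u v.
Proof. by rewrite /pairing -scalemxAl mxE. Qed.

Lemma pairing_linear u : exists2 L : {linear 'rV[R]_n -> R},
  continuous L & forall v, L v = pairing u v.
Proof.
have lin : linear (pairing u).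
  by move=> c v w; rewrite !(pairingC u) pairingDl pairingZl.
pose LM := GRing.isLinear.Build _ _ _ _ _ lin.
pose L : {linear 'rV[R]_n -> R} := HB.pack (pairing u) LM.
exists L => //.
have C : Ck 0 setT (fun v => (v *m u^T) 0 0).
  exact: (Ck_coord 0 0 openT (Ck_mulmxr u^T openT (Ck_id 0 setT))).
have E : (L : 'rV[R]_n -> R) = (fun v => (v *m u^T) 0 0).
  by apply/funext => v; rewrite -[LHS]/(pairing u v) pairingC.
by move=> v; rewrite E; exact: C.
Qed.

Lemma radial_derive a p0 h k (t : R) : differentiable a (p0 + t *: h) ->
  is_derive t 1 (fun s => pairing (a (p0 + s *: h)) k)
    (pairing (h *m 'J a (p0 + t *: h)) k).
Proof.
move=> da; have [d E] := derive_pairing h k da.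
have := is_derive_line (f := fun q => pairing (a q) k) d.
by rewrite E (deriveEjacobian _ da).
Qed.

(** The primitive is the integral along the ray from p0, F p = \int_0^1 a(p0 + t h) h
    with h = p - p0. To differentiate it, compare the primitives along the rays to
    p + k and to p: the function
      D(t) = (primitive for p + k) - (primitive for p) - t a(p0 + t h) k
    increases over [0, 1] by F (p + k) - F p - a(p) k. With x = p0 + t h, closedness
    gives
      D'(t) = (a(x + t k) - a(x) - t D_k a(x)) h + (a(x + t k) - a(x)) k,
    which is O(|k|^2) by the uniform Taylor estimate. *)
Theorem closed_form_primitive (U : set 'rV[R]_n) a p0 :
  open U -> Ck 2 U a -> U p0 -> (forall p, U p -> ('J a p)^T = 'J a p) ->
  exists (r : R) (F : 'rV[R]_n -> R), 0 < r /\
    forall p, `|p - p0| < r ->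
      [/\ U p, differentiable F p & forall v, 'D_v F p = pairing (a p) v].
Proof.
move=> oU ca Up0 sym.
have [r [M [r0 M0 rU est]]] := second_order_estimate oU ca Up0.
have inr p (t : R) : `|p - p0| < r -> 0 <= t <= 1 ->
    `|p0 + t *: (p - p0) - p0| <= r.
  move=> pr /andP[t0 t1]; rewrite [p0 + _]addrC addrK normrZ ger0_norm //.
  by apply: le_trans (ltW pr); rewrite ler_piMl.
have da p : U p -> differentiable a p by exact: ca.1.
have prim p : exists phi : R -> R, `|p - p0| < r ->
    {within `[0, 1], continuous phi} /\
    forall t : R, 0 < t < 1 ->
      is_derive t 1 phi (pairing (a (p0 + t *: (p - p0))) (p - p0)).
  have [pr|] := pselect (`|p - p0| < r); last by exists (cst 0).
  have [|phi h] := @continuous_primitive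
      (fun t => pairing (a (p0 + t *: (p - p0))) (p - p0)) 0 1 ltr01.
    move=> t t01; apply: differentiable_continuous; apply/derivable1_diffP.
    by have [] := radial_derive (p - p0) (da _ (rU _ (inr p t pr t01))).
  by exists phi.
have [phi phiP] := choice prim.
pose F p := phi p 1 - phi p 0.
have quad p k : `|p - p0| < r -> `|p + k - p0| < r ->
    `|F (p + k) - F p - pairing (a p) k| <= n%:R * M * (r + 1) * `|k| ^+ 2.
  move=> pr pkr; set h := p - p0.
  have hk : p + k - p0 = h + k by rewrite addrAC.
  have [c1 d1] := phiP _ pr; have [c2 d2] := phiP _ pkr.
  pose lin (t : R) := t * pairing (a (p0 + t *: h)) k.
  have d3 (t : R) : 0 <= t <= 1 -> is_derive t 1 lin
     (t * pairing (h *m 'J a (p0 + t *: h)) k + pairing (a (p0 + t *: h)) k).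
    move=> t01.
    have d := radial_derive k (da _ (rU _ (inr p t pr t01))).
    apply: (is_derive_eq (is_deriveM (is_derive_id t 1) d)).
    by congr (_ + _); exact: mulr1.
  have [||c cI E] := @MVT _ (fun t => phi (p + k) t - phi p t - lin t)
     (fun t => pairing (a (p0 + t *: (p + k - p0))) (p + k - p0)
       - pairing (a (p0 + t *: h)) h
       - (t * pairing (h *m 'J a (p0 + t *: h)) k + pairing (a (p0 + t *: h)) k))
     0 1 ltr01.
  - move=> t; rewrite in_itv /= => t01.
    have t01' : 0 <= t <= 1 by have [? ?] := andP t01; rewrite !ltW.
    exact: (is_deriveB (is_deriveB (d2 _ t01) (d1 _ t01)) (d3 _ t01')).
  - have c3 : {within `[0, 1], continuous lin}.
      apply: continuous_in_subspaceT => t; rewrite inE /= in_itv /= => t01.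
      apply: differentiable_continuous; apply/derivable1_diffP.
      by have [] := d3 t t01.
    by move=> x; exact: (cvgB (cvgB (c2 x) (c1 x)) (c3 x)).
  move: cI; rewrite in_itv /= => /andP[/ltW t0 /ltW t1].
  have c01 : 0 <= c <= 1 by rewrite t0.
  set x := p0 + c *: h.
  have xr : `|x - p0| <= r by exact: inr.
  have xE : p0 + c *: (p + k - p0) = x + c *: k.
    by rewrite hk scalerDr addrA.
  have xkr : `|x + c *: k - p0| <= r by rewrite -xE; exact: inr.
  have [e1 e2] := est x (c *: k) xr xkr.
  (* This is where closedness enters. *)
  have swap : pairing (h *m 'J a x) k = pairing (k *m 'J a x) h.
    rewrite pairingC /pairing trmx_mul sym ?mulmxA //; exact: rU.
  have {E} -> : F (p + k) - F p - pairing (a p) k =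
      pairing (a (x + c *: k) - a x - (c *: k) *m 'J a x) h +
      pairing (a (x + c *: k) - a x) k.
    move: E; rewrite /lin scale1r scale0r mul0r mul1r !subr0 mulr1.
    rewrite /h [p0 + (p - p0)]addrC subrK -/h xE hk -/x swap /F => E.
    transitivity (phi (p + k) 1 - phi p 1 - pairing (a p) k
                  - (phi (p + k) 0 - phi p 0)); first by ring.
    rewrite E pairingC pairingDl -!(pairingC (a _)) !pairingBl -scalemxAl pairingZl.
    by ring.
  have kc : `|c *: k| <= `|k| by rewrite normrZ ger0_norm // ler_piMl.
  have e1' : `|a (x + c *: k) - a x| <= M * `|k|.
    by apply: le_trans e1 _; rewrite ler_wpM2l.
  have e2' : `|a (x + c *: k) - a x - (c *: k) *m 'J a x| <= M * `|k| ^+ 2.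
    by apply: le_trans e2 _; rewrite ler_wpM2l // lerXn2r // nnegrE.
  apply: le_trans (ler_normD _ _) _.
  apply: (@le_trans _ _ (n%:R * (M * `|k| ^+ 2 * r) + n%:R * (M * `|k| * `|k|))).
    apply: lerD; apply: le_trans (norm_pairing _ _) _; rewrite ler_wpM2l //.
      by apply: ler_pM => //; exact: ltW.
    by apply: ler_pM.
  by rewrite le_eqVlt; apply/orP; left; apply/eqP; ring.
exists r, F; split=> // p pr.
have [L cL LE] := pairing_linear (a p).
have [|dF DF] := diff_small_unique (f := F) (p := p) cL; last first.
  split=> //; first exact/rU/ltW.
  by move=> v; rewrite DF LE.
move=> e e0; set K := n%:R * M * (r + 1) + 1.
have K0 : 0 < K by rewrite ltr_wpDl // !mulr_ge0 // addr_ge0 // ltW.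
apply/nbhs_ballP; exists (Num.min (r - `|p - p0|) (e / K)) => /=.
  by rewrite lt_min subr_gt0 pr divr_gt0.
move=> k; rewrite -ball_normE /= sub0r normrN lt_min => /andP[k1 k2].
rewrite LE; have pkr : `|p + k - p0| < r.
  by rewrite addrAC; apply: le_lt_trans (ler_normD _ _) _; rewrite -ltrBrDl.
apply: le_trans (quad p k pr pkr) _; rewrite expr2 mulrA ler_wpM2r //.
apply: (@le_trans _ _ (K * `|k|)); first by rewrite ler_wpM2r // lerDl.
by rewrite mulrC -ler_pdivlMr // ltW.
Qed.

End Poincare.

(** * Coordinates adapted to a closed coframe *)

Section ClosedCoframe.
Context {R : realType} {n : nat}.
Implicit Types (p q v : 'rV[R]_n).

(** The primitives of the forms are the coordinates: they assemble into a map whose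
    derivative along v is the vector of values of the forms on v, so independence at
    p0 is invertibility of the Jacobian. *)
Theorem closed_coframe_coordinates (U : set 'rV[R]_n)
    (a : 'I_n -> 'rV[R]_n -> 'rV[R]_n) p0 :
  open U -> (forall i, smooth U (a i)) -> U p0 ->
  (forall i p, U p -> ('J (a i) p)^T = 'J (a i) p) ->
  (forall v, (forall i, pairing (a i p0) v = 0) -> v = 0) ->
  exists (V W : set 'rV[R]_n) (phi : 'rV[R]_n -> 'rV[R]_n),
    [/\ W p0, W `<=` U, diffeomorphism V W phi &
      forall q, V q -> differentiable phi q /\
        forall v i, pairing (a i (phi q)) ('D_v phi q) = v 0 i].
Proof.
move=> oU sa Up0 sym indep.
have /choice[r /choice[F FP]] : forall i, exists r : R,
    exists F : 'rV[R]_n -> R, 0 < r /\ forall p, `|p - p0| < r ->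
      [/\ U p, differentiable F p & forall v, 'D_v F p = pairing (a i p) v].
  move=> i; have [r [F h]] := closed_form_primitive oU (sa i 2) Up0 (sym i).
  by exists r, F.
pose good i := [set p | U p /\ differentiable (F i) p /\
    forall v, 'D_v (F i) p = pairing (a i p) v].
have near_all : nbhs p0 [set p | forall i, good i p].
  apply: (@filter_forall _ _ good (nbhs p0)) => i; have [r0 h] := FP i.
  apply/nbhs_ballP; exists (r i) => //= p; rewrite -ball_normE /= distrC => pr.
  by have [] := h p pr.
have [s /= s0 sP] := (nbhs_ballP _ _).1 (filterI (near_open oU Up0 (fun q h => h)) near_all).
pose U' : set 'rV[R]_n := ball p0 s.
have oU' : open U' by exact: ball_open.
have U'p0 : U' p0 by exact: ballxx.
have UU' p : U' p -> U p by move=> /sP[].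
have dF p i : U' p -> differentiable (F i) p by move=> /sP[_ /(_ i)[_ []]].
have DF p i v : U' p -> 'D_v (F i) p = pairing (a i p) v.
  by move=> /sP[_ /(_ i)[_ [_]]].
pose Psi p : 'rV[R]_n := \row_i F i p.
have dPsi p : U' p -> differentiable Psi p.
  move=> U'p; apply/differentiable_mxP => i j.
  rewrite (_ : (fun q => Psi q i j) = F j); first exact: dF.
  by apply/funext => q; rewrite mxE.
have DPsi p v i : U' p -> ('D_v Psi p) 0 i = pairing (a i p) v.
  move=> U'p; rewrite -derive_coord; last exact/diff_derivable/dPsi.
  rewrite (_ : (fun q => Psi q 0 i) = F i); first exact: DF.
  by apply/funext => q; rewrite mxE.
have sPsi : smooth U' Psi.
  case=> [p U'p|k]; first exact/differentiable_continuous/dPsi.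
  split=> // v; apply: Ck_mx => // i j; rewrite ord1.
  have C : Ck k U' (fun p => (a j p *m v^T) 0 0).
    apply: (Ck_coord 0 0 oU'); apply: (Ck_mulmxr _ oU').
    exact: (Ck_subset UU' (sa j k)).
  by apply: (Ck_eq oU' _ C) => p U'p; rewrite DPsi.
have uJ : 'J Psi p0 \in unitmx.
  rewrite -row_free_unit; apply: inj_row_free => v vJ; apply: indep => i.
  by rewrite -(DPsi _ _ _ U'p0) (deriveEjacobian _ (dPsi _ U'p0)) vJ mxE.
have [V [W [phi [Wp0 WU' dphi inv]]]] :=
  inverse_function_theorem oU' sPsi U'p0 uJ.
exists V, W, phi; split=> // [p /WU'/UU' //|q Vq].
have [oV _ sphi VW _] := dphi.
have U'q : U' (phi q) by exact/WU'/VW.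
have dq : differentiable phi q by exact: (sphi 1).1.
split=> // v i.
have E : 'D_v (Psi \o phi) q = v.
  rewrite -[RHS](derive_id q v); apply: near_eq_derive.
  exact: (near_open oV Vq).
apply: (eq_trans (esym (DPsi _ _ i U'q))).
apply: (eq_trans _ (congr1 (fun u : 'rV[R]_n => u 0 i) E)).
apply: (congr1 (fun u : 'rV[R]_n => u 0 i)).
have dP := dPsi _ U'q.
rewrite (deriveE _ (differentiable_comp dq dP)) (diff_comp dq dP) /=.
by rewrite (deriveE _ dP) (deriveE _ dq).
Qed.

End ClosedCoframe.

(** * Lorentzian linear algebra *)

Section MinkowskiProduct.
Context {R : realType}.
Implicit Types a b c e n : 'rV[R]_4.

Lemma minkC a b : mink a b = mink b a.
Proof. by apply: eq_bigr => i _; rewrite [a 0 i * _]mulrC. Qed.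

Lemma minkDl a b c : mink (a + b) c = mink a c + mink b c.
Proof. by rewrite /mink -big_split; apply: eq_bigr => i _; rewrite !mxE /=; ring. Qed.

Lemma minkZl (k : R) a b : mink (k *: a) b = k * mink a b.
Proof. by rewrite /mink mulr_sumr; apply: eq_bigr => i _; rewrite !mxE /=; ring. Qed.

Lemma minkNl a b : mink (- a) b = - mink a b.
Proof. by rewrite -scaleN1r minkZl mulN1r. Qed.

Lemma minkBl a b c : mink (a - b) c = mink a c - mink b c.
Proof. by rewrite minkDl minkNl. Qed.

Lemma minkDr a b c : mink a (b + c) = mink a b + mink a c.
Proof. by rewrite minkC minkDl !(minkC _ a). Qed.

Lemma minkZr (k : R) a b : mink a (k *: b) = k * mink a b.
Proof. by rewrite minkC minkZl (minkC a). Qed.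

Lemma minkNr a b : mink a (- b) = - mink a b.
Proof. by rewrite minkC minkNl (minkC a). Qed.

Lemma minkBr a b c : mink a (b - c) = mink a b - mink a c.
Proof. by rewrite minkDr minkNr. Qed.

Lemma mink0l a : mink 0 a = 0.
Proof. by rewrite -(scale0r a) minkZl mul0r. Qed.

Definition minkE := (minkDl, minkDr, minkBl, minkBr, minkNl, minkNr, minkZl, minkZr).

Definition frame_mx a b c e : 'M[R]_4 :=
  \matrix_(i, j) (nth 0 [:: a; b; c; e] i) 0 j.

(** The vector representing the linear form e |-> det (a, b, c, e) for the product
    mink; hence the sign on the timelike coordinate. *)
Definition minkowski_cross a b c : 'rV[R]_4 :=
  \row_k ((if k == ord_max then -1 else 1) *
          cofactor (frame_mx a b c 0) ord_max k).

Lemma mink_cross a b c e : mink (minkowski_cross a b c) e = \det (frame_mx a b c e).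
Proof.
rewrite (expand_det_row _ ord_max); apply: eq_bigr => k _.
rewrite !mxE /= [RHS]mulrC mulrA [X in X * _]mulrA.
have -> : (if k == ord_max then -1 else 1 : R) * (if k == ord_max then -1 else 1) = 1.
  by case: (k == ord_max); rewrite ?mulrNN mulr1.
rewrite mul1r; congr (_ * _); rewrite /cofactor; congr (_ * \det _).
apply/matrixP => i j; rewrite !mxE; case: i => [[|[|[|//]]] ?] //=.
Qed.

Lemma cross_orthogonal a b c :
  [/\ mink (minkowski_cross a b c) a = 0, mink (minkowski_cross a b c) b = 0 &
      mink (minkowski_cross a b c) c = 0].
Proof.
pose o k (lk : (k < 4)%N) : 'I_4 := Ordinal lk.
rewrite !mink_cross; split.
- apply: (determinant_alternate (i1 := @o 0 isT) (i2 := ord_max)) => // j.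
  by rewrite !mxE.
- apply: (determinant_alternate (i1 := @o 1 isT) (i2 := ord_max)) => // j.
  by rewrite !mxE.
- apply: (determinant_alternate (i1 := @o 2 isT) (i2 := ord_max)) => // j.
  by rewrite !mxE.
Qed.

Lemma mul_frame_mx (w : 'rV[R]_4) a b c e :
  w *m frame_mx a b c e = w 0 (inord 0) *: a + w 0 (inord 1) *: b +
                          w 0 (inord 2) *: c + w 0 (inord 3) *: e.
Proof.
apply/rowP => j; rewrite !mxE !big_ord_recl big_ord0 !mxE /= addr0 !addrA.
congr (_ + _); [congr (_ + _); [congr (_ + _)|]|]; congr (w 0 _ * _);
  by apply/val_inj; rewrite /= inordK.
Qed.

(** Multiplying the frame matrix by n, with the sign of its timelike coordinate
    changed, gives the column of the four products. *)
Lemma orthogonal_to_frame_eq0 a b c e n : frame_mx a b c e \in unitmx ->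
  mink a n = 0 -> mink b n = 0 -> mink c n = 0 -> mink e n = 0 -> n = 0.
Proof.
move=> uF an bn cn en.
pose en' : 'cV[R]_4 := \col_k ((if k == ord_max then -1 else 1) * n 0 k).
have row_mink x : mink x n = \sum_k x 0 k * en' k 0.
  by apply: eq_bigr => k _; rewrite !mxE; ring.
have F0 : frame_mx a b c e *m en' = 0.
  apply/colP => i; rewrite mxE [RHS]mxE.
  under eq_bigr do rewrite mxE.
  rewrite -row_mink; case: i => [[|[|[|[|//]]]] ?] //=.
have /colP en0 : en' = 0 by rewrite -[en'](mulKmx uF) F0 mulmx0.
apply/rowP => k; have := en0 k; rewrite !mxE.
by case: (k == ord_max) => [/eqP|]; rewrite ?mulN1r ?oppr_eq0 ?mul1r // => /eqP.
Qed.

Variable V : normedModType R.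
Implicit Types (f g : V -> 'rV[R]_4) (p v : V).

Lemma Ck_mink k (U : set V) f g :
  open U -> Ck k U f -> Ck k U g -> Ck k U (fun p => mink (f p) (g p)).
Proof.
move=> oU cf cg; apply: Ck_sum => // i.
apply: (Ck_mul oU); first exact: Ck_cst.
by apply: (Ck_mul oU); exact: Ck_coord.
Qed.

Lemma is_derive_mink f g p v : differentiable f p -> differentiable g p ->
  is_derive p v (fun q => mink (f q) (g q))
    (mink ('D_v f p) (g p) + mink (f p) ('D_v g p)).
Proof.
move=> df dg.
pose c (i : 'I_4) : R := if i == ord_max then -1 else 1.
pose h i : V -> R := c i *: ((fun q => f q 0 i) * (fun q => g q 0 i)).
have dfi i : derivable (fun q => f q 0 i) p v.
  by apply: diff_derivable; exact: (differentiable_mxP _ _).1.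
have dgi i : derivable (fun q => g q 0 i) p v.
  by apply: diff_derivable; exact: (differentiable_mxP _ _).1.
have dh i : is_derive p v (h i)
    (c i * (f p 0 i * ('D_v g p) 0 i + g p 0 i * ('D_v f p) 0 i)).
  have d := derivableM (dfi i) (dgi i).
  split; first exact: derivableZ.
  rewrite (deriveZ _ d) (deriveM (dfi i) (dgi i)).
  by rewrite (derive_coord 0 i (diff_derivable df)) (derive_coord 0 i (diff_derivable dg)).
have -> : (fun q => mink (f q) (g q)) = \sum_(i < 4) h i.
  by apply/funext => q; rewrite fct_sumE.
have dhi i : derivable (h i) p v by case: (dh i).
split; first exact: derivable_sum.
rewrite (derive_sum dhi).
rewrite /mink -big_split; apply: eq_bigr => i _ /=.
case: (dh i) => _ ->; rewrite -/(c i) -mulrDr; congr (_ * _).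
by rewrite addrC; congr (_ + _); exact: mulrC.
Qed.

Lemma derive_mink f g p v : differentiable f p -> differentiable g p ->
  'D_v (fun q => mink (f q) (g q)) p = mink ('D_v f p) (g p) + mink (f p) ('D_v g p).
Proof. by move=> df dg; case: (is_derive_mink v df dg). Qed.

End MinkowskiProduct.

(** * The Codazzi equation as closedness *)

(** A and B stand for D_v alpha(w) and D_w alpha(v). The first two equations come from
    alpha = m <X, dz>, the next two from alpha = - <X, d nu>; the values of tv and tw
    are those of <D X, X> when <X, X> = 1 / m. The two expressions of A - B are
    opposite. *)
Lemma codazzi_cancellation (F : realFieldType)
    (A B k kv kw av aw bv bw tv tw sv sw Cz Cn : F) : k != 0 ->
  A = k * (aw * tv + bw * sv + Cz) + aw / k * kv ->
  B = k * (av * tw + bv * sw + Cz) + av / k * kw ->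
  A = - (- k * (aw * tv - bw * sv) + Cn) ->
  B = - (- k * (av * tw - bv * sw) + Cn) ->
  2 * tv = - k ^- 2 * kv -> 2 * tw = - k ^- 2 * kw -> A = B.
Proof.
move=> k0 A1 B1 A2 B2 Tv Tw.
have tvE : tv = - k ^- 2 * kv / 2 by rewrite -Tv; field.
have twE : tw = - k ^- 2 * kw / 2 by rewrite -Tw; field.
have E : (A - B) + (A - B) = 0.
  by rewrite {1}A1 {1}B1 A2 B2 tvE twE; field.
by apply/eqP; rewrite -subr_eq0; move/eqP: E; rewrite -mulr2n mulrn_eq0.
Qed.

(** al w q and be w q are the values at q of the forms alpha and beta on the constant
    vector w, so that D_v (al w) = D_w (al v) means d alpha = 0. *)
Section CodazziClosed.
Context {R : realType} {V : normedModType R}.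
Variables (U : set V) (z nu X Y : V -> 'rV[R]_4) (m : V -> R) (al be : V -> V -> R).
Hypotheses (oU : open U) (cz : Ck 2 U z) (cnu : Ck 2 U nu).
Hypotheses (dX : forall q, U q -> differentiable X q)
  (dm : forall q, U q -> differentiable m q) (m0 : forall q, U q -> m q != 0).
Hypotheses
  (zE : forall q w, U q -> 'D_w z q = al w q *: X q + be w q *: Y q)
  (nuE : forall q w, U q -> 'D_w nu q = - m q *: (al w q *: X q - be w q *: Y q))
  (XX : forall q, U q -> mink (X q) (X q) = (m q)^-1)
  (XY : forall q, U q -> mink (X q) (Y q) = 0).

Let DXX p v : U p -> 2 * mink ('D_v X p) (X p) = - (m p) ^- 2 * 'D_v m p.
Proof.
move=> Up.
have E : 'D_v (fun q => mink (X q) (X q)) p = 'D_v (fun q => (m q)^-1) p.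
  by apply: near_eq_derive; exact: (near_open oU Up).
move: E; rewrite (derive_mink v (dX Up) (dX Up)).
rewrite (deriveV (m0 Up) (diff_derivable (v := v) (dm Up))) => E.
apply: (eq_trans _ E).
by rewrite (minkC (X p)) mulr2n mulrDl mul1r.
Qed.

Let al_z q w : U q -> m q * mink (X q) ('D_w z q) = al w q.
Proof.
move=> Uq; rewrite zE // !minkE XX // XY // mulr0 addr0 mulrCA mulfV ?m0 //.
exact: mulr1.
Qed.

Let al_nu q w : U q -> - mink (X q) ('D_w nu q) = al w q.
Proof.
move=> Uq; rewrite nuE // !minkE XX // XY // mulr0 subr0 mulNr opprK mulrCA.
by rewrite mulfV ?m0 // mulr1.
Qed.

Let D1 p v w : U p -> 'D_v (al w) p =
  m p * (mink ('D_v X p) ('D_w z p) + mink (X p) ('D_v ('D_w z) p)) +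
  mink (X p) ('D_w z p) * 'D_v m p.
Proof.
move=> Up; have dDz : differentiable ('D_w z) p by exact: (cz.2 w).1.
have [dXz EXz] := is_derive_mink v (dX Up) dDz.
have E : 'D_v (al w) p = 'D_v (m * (fun q => mink (X q) ('D_w z q))) p.
  by apply: near_eq_derive; apply: (near_open oU Up) => q Uq; rewrite -al_z.
by rewrite E (deriveM (diff_derivable (dm Up)) dXz) EXz.
Qed.

Let D2 p v w : U p -> 'D_v (al w) p =
  - (mink ('D_v X p) ('D_w nu p) + mink (X p) ('D_v ('D_w nu) p)).
Proof.
move=> Up; have dDnu : differentiable ('D_w nu) p by exact: (cnu.2 w).1.
have [dXnu EXnu] := is_derive_mink v (dX Up) dDnu.
have E : 'D_v (al w) p = 'D_v (- (fun q => mink (X q) ('D_w nu q))) p.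
  by apply: near_eq_derive; apply: (near_open oU Up) => q Uq; rewrite -al_nu.
by rewrite E (deriveN dXnu) EXnu.
Qed.

(** The second derivatives of z and nu contribute <X, D_v D_w z> and <X, D_v D_w nu>,
    symmetric in v and w; what remains is linear in the products of D X with X and Y,
    where [codazzi_cancellation] applies. *)
Lemma codazzi_closed p v w : U p -> 'D_v (al w) p = 'D_w (al v) p.
Proof.
move=> Up; have mp := m0 Up.
have Tv := DXX v Up; have Tw := DXX w Up.
have XZ u : mink (X p) ('D_u z p) = al u p / m p.
  by rewrite zE // !minkE XX // XY // mulr0 addr0.
have Z u t : mink ('D_u X p) ('D_t z p) =
    al t p * mink ('D_u X p) (X p) + be t p * mink ('D_u X p) (Y p).
  by rewrite zE // !minkE.
have N u t : mink ('D_u X p) ('D_t nu p) =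
    - m p * (al t p * mink ('D_u X p) (X p) - be t p * mink ('D_u X p) (Y p)).
  by rewrite nuE // !minkE.
have A1 := D1 v w Up; have B1 := D1 w v Up.
have A2 := D2 v w Up; have B2 := D2 w v Up.
rewrite (Z v w) (XZ w) in A1; rewrite (Z w v) (XZ v) in B1.
rewrite (N v w) in A2; rewrite (N w v) in B2.
rewrite (derive_commutes_mx w v oU cz Up) in B1.
rewrite (derive_commutes_mx w v oU cnu Up) in B2.
exact: (codazzi_cancellation mp A1 B1 A2 B2 Tv Tw).
Qed.

End CodazziClosed.

(** * Tangent and normal vectors of a spacelike surface *)

Section SurfaceGeometry.
Context {R : realType}.
Variables (U : set 'rV[R]_2) (z : 'rV[R]_2 -> 'rV[R]_4).
Hypothesis hz : spacelike_surface U z.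
Implicit Types (p v w x y : 'rV[R]_2) (b l n : 'rV[R]_4).

Let oU : open U. Proof. by case: hz. Qed.
Let sz : smooth U z. Proof. by case: hz. Qed.
Let g_gt0 p v : U p -> v != 0 -> 0 < first_form z p v v.
Proof. by case: hz => _ _; exact. Qed.

Lemma surface_differentiable p : U p -> differentiable z p.
Proof. exact: (sz 1).1. Qed.

Lemma rV2_basis v : v = v 0 0 *: du + v 0 1 *: dv.
Proof.
rewrite {1}[v]row_sum_delta !big_ord_recl big_ord0 addr0.
by congr (_ + _ *: delta_mx _ _); [congr (v 0 _)|]; apply/val_inj.
Qed.

Lemma derive_combination p v w (s t : R) : U p ->
  'D_(s *: v + t *: w) z p = s *: 'D_v z p + t *: 'D_w z p.
Proof.
move=> Up; have dz := surface_differentiable Up.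
by rewrite (derive_add _ _ dz) !(derive_scale _ _ dz).
Qed.

Lemma derive_basis p v : U p ->
  'D_v z p = v 0 0 *: 'D_du z p + v 0 1 *: 'D_dv z p.
Proof.
move=> Up; apply: (eq_trans _ (derive_combination du dv (v 0 0) (v 0 1) Up)).
by congr (derive z p _); exact: rV2_basis.
Qed.

Lemma normal_vector_basis p n : U p ->
  mink n ('D_du z p) = 0 -> mink n ('D_dv z p) = 0 -> normal_vector z p n.
Proof.
move=> Up nu nv v; apply: (eq_trans (congr1 (mink n) (derive_basis v Up))).
move: ('D_du z p) ('D_dv z p) nu nv => a c na nc.
by rewrite minkDr !minkZr na nc !mulr0 addr0.
Qed.

Lemma first_formC p v w : first_form z p v w = first_form z p w v.
Proof. exact: minkC. Qed.

Lemma first_form_combination p v w x (s t : R) : U p ->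
  first_form z p (s *: v + t *: w) x = s * first_form z p v x + t * first_form z p w x.
Proof.
move=> Up; rewrite /first_form (derive_combination v w s t Up).
by move: ('D_v z p) ('D_w z p) => a c; rewrite minkDl !minkZl.
Qed.

Lemma first_form_eq0 p v : U p -> first_form z p v v = 0 -> v = 0.
Proof.
move=> Up g0; apply/eqP/negPn/negP => v0.
by have := g_gt0 Up v0; rewrite g0 ltxx.
Qed.

(** Pairing a vanishing combination with l, then with b, kills its normal
    coefficients; the tangent part is then a null vector of the first form. *)
Lemma surface_frame_unit p b l : U p ->
  normal_vector z p b -> normal_vector z p l ->
  mink b l = 0 -> mink b b != 0 -> mink l l != 0 ->
  frame_mx ('D_du z p) ('D_dv z p) b l \in unitmx.
Proof.
move=> Up nb nl bl bb ll; rewrite -row_free_unit; apply: inj_row_free => w.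
have -> : w = \row_i w 0 i by apply/rowP => i; rewrite mxE.
rewrite mul_frame_mx !mxE -(derive_combination _ _ _ _ Up) => E.
set w0 := w 0 (inord 0) in E *; set w1 := w 0 (inord 1) in E *.
set w2 := w 0 (inord 2) in E *; set w3 := w 0 (inord 3) in E *.
set v := w0 *: du + w1 *: dv in E.
have z0 (a : 'rV[R]_4) : mink 0 a = 0 by exact: mink0l.
have w3_0 : w3 = 0.
  have := z0 l; rewrite -E !minkE (minkC ('D_v z p)) nl bl mulr0 !add0r.
  by move/eqP; rewrite mulf_eq0 (negPf ll) orbF => /eqP.
have w2_0 : w2 = 0.
  have := z0 b; rewrite -E !minkE (minkC ('D_v z p)) nb w3_0 mul0r add0r addr0.
  by move/eqP; rewrite mulf_eq0 (negPf bb) orbF => /eqP.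
have v0 : v = 0.
  apply: (first_form_eq0 Up); move: E.
  by rewrite w2_0 w3_0 !scale0r !addr0 /first_form => ->.
have w0_0 : w0 = 0.
  by move/rowP : v0 => /(_ 0); rewrite !mxE /= mulr1 mulr0 addr0.
have w1_0 : w1 = 0.
  by move/rowP : v0 => /(_ 1); rewrite !mxE /= mulr1 mulr0 add0r.
apply/rowP => i; rewrite !mxE.
have -> : i = inord i by apply/val_inj; rewrite /= inordK.
by case: i => [[|[|[|[|//]]]] ?].
Qed.

Lemma orthogonal_complement_eq0 p b l n : U p ->
  normal_vector z p b -> normal_vector z p l ->
  mink b l = 0 -> mink b b != 0 -> mink l l != 0 ->
  (forall v, mink ('D_v z p) n = 0) -> mink b n = 0 -> mink l n = 0 -> n = 0.
Proof.
move=> Up nb nl bl bb ll nz nbn nln.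
by apply: (orthogonal_to_frame_eq0 (surface_frame_unit Up nb nl bl bb ll)).
Qed.

Lemma tangential_part_orthogonal p a n :
  normal_vector z p n -> mink (tangential_part z p a) n = 0.
Proof.
move=> nn; have mink_sum (F : 'I_2 -> 'rV[R]_4) :
    (forall i, mink (F i) n = 0) -> mink (\sum_i F i) n = 0.
  move=> F0; apply: (big_ind (fun s => mink s n = 0)) => [|s t s0 t0|i _]; first exact: mink0l.
    by rewrite minkDl s0 t0 addr0.
  exact: F0.
apply: (mink_sum _) => i; apply: (mink_sum _) => j.
by rewrite minkZl (minkC _ n) nn mulr0.
Qed.

Lemma sigma_normal p v w n :
  normal_vector z p n -> mink (sigma z p v w) n = mink ('D_v ('D_w z) p) n.
Proof.
by move=> nn; rewrite /sigma /normal_part minkBl tangential_part_orthogonal // subr0.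
Qed.

(** A vanishing normal part means that the derivative is its own tangential part. *)
Lemma parallel_orthogonal (xi : 'rV[R]_2 -> 'rV[R]_4) p v n :
  normal_connection z xi p v = 0 -> normal_vector z p n -> mink ('D_v xi p) n = 0.
Proof.
move=> xi0 nn; have := tangential_part_orthogonal ('D_v xi p) nn.
move: xi0; rewrite /normal_connection /normal_part => /subr0_eq <-.
by [].
Qed.

(** In dimension two an orthonormal pair is a basis, and pairing with x and y reads
    off the coefficients. *)
Lemma orthonormal_expansion p x y : U p ->
  first_form z p x x = 1 -> first_form z p y y = 1 -> first_form z p x y = 0 ->
  forall v, v = first_form z p v x *: x + first_form z p v y *: y.
Proof.
move=> Up xx yy xy v; set s := first_form z p v x; set t := first_form z p v y.
pose M : 'M[R]_2 := \matrix_(i, j) (if i == 0 then x else y) 0 j.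
have mulM (a : 'rV[R]_2) : a *m M = a 0 0 *: x + a 0 1 *: y.
  apply/rowP => j; rewrite !mxE !big_ord_recl big_ord0 !mxE /= addr0.
  by congr (_ + a 0 _ * _); apply/val_inj.
have gx (a c : R) : first_form z p (a *: x + c *: y) x = a.
  by rewrite (first_form_combination _ _ _ _ _ Up) xx first_formC xy mulr1 mulr0 addr0.
have gy (a c : R) : first_form z p (a *: x + c *: y) y = c.
  by rewrite (first_form_combination _ _ _ _ _ Up) yy xy mulr1 mulr0 add0r.
have uM : M \in unitmx.
  rewrite -row_free_unit; apply: inj_row_free => a; rewrite mulM => a0.
  have z0 w : first_form z p 0 w = 0.
    by rewrite /first_form derive0 mink0l.
  rewrite [a]rV2_basis -(gx (a 0 0) (a 0 1)) -{2}(gy (a 0 0) (a 0 1)) a0 !z0.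
  by rewrite !scale0r addr0.
have vE : v = (v *m invmx M) 0 0 *: x + (v *m invmx M) 0 1 *: y.
  by rewrite -mulM mulmxKV.
by rewrite /s /t {2 3}vE gx gy.
Qed.

End SurfaceGeometry.

(** * A smooth unit normal orthogonal to the mean curvature *)

Section NormalField.
Context {R : realType}.
Variables (U : set 'rV[R]_2) (z : 'rV[R]_2 -> 'rV[R]_4).
Hypothesis hz : spacelike_surface U z.
Implicit Types (p v w x y : 'rV[R]_2).

Let oU : open U. Proof. by case: hz. Qed.
Let sz : smooth U z. Proof. by case: hz. Qed.

Definition normal_frame p (b l : 'rV[R]_4) : Prop :=
  [/\ normal_vector z p b, normal_vector z p l, mink b l = 0 &
      exists2 eps : R, eps = 1 \/ eps = -1 & mink b b = eps /\ mink l l = - eps].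

Lemma Ck_frame_mx k (A : set 'rV[R]_2) (a b c e : 'rV[R]_2 -> 'rV[R]_4) :
  open A -> Ck k A a -> Ck k A b -> Ck k A c -> Ck k A e ->
  Ck k A (fun p => frame_mx (a p) (b p) (c p) (e p)).
Proof.
move=> oA ca cb cc ce; apply: Ck_mx => // i j.
have C (f g : 'rV[R]_2 -> 'rV[R]_4) : Ck k A g ->
    (forall p, f p = g p) -> Ck k A (fun p => f p 0 j).
  move=> cg fg; apply: (Ck_eq oA _ (Ck_coord 0 j oA cg)) => p _.
  by rewrite fg.
apply: (Ck_eq (f := fun p => (nth 0 [:: a p; b p; c p; e p] i) 0 j)) => //.
  by move=> p _; rewrite mxE.
case: i => [[|[|[|[|//]]]] ?] /=; [exact: (C _ a)|exact: (C _ b)|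
                                   exact: (C _ c)|exact: (C _ e)].
Qed.

Lemma Ck_cross k (A : set 'rV[R]_2) (a b c : 'rV[R]_2 -> 'rV[R]_4) :
  open A -> Ck k A a -> Ck k A b -> Ck k A c ->
  Ck k A (fun p => minkowski_cross (a p) (b p) (c p)).
Proof.
move=> oA ca cb cc; apply: Ck_mx => // i j.
have cF := Ck_frame_mx oA ca cb cc (Ck_cst k A (0 : 'rV[R]_4)).
pose F p := frame_mx (a p) (b p) (c p) 0.
have C : Ck k A (fun p => (if j == ord_max then -1 else 1 : R) *
    ((-1) ^+ (@ord_max 3 + j) * \det (row' ord_max (col' j (F p))))).
  apply: (Ck_mul oA); first exact: Ck_cst.
  apply: (Ck_mul oA); first exact: Ck_cst.
  apply: Ck_det => //; apply: Ck_mx => // s t.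
  apply: (Ck_eq oA _ (Ck_coord (lift ord_max s) (lift j t) oA cF)) => p _.
  by rewrite [in RHS]mxE [in RHS]mxE.
by apply: (Ck_eq oA _ C) => p _; rewrite mxE.
Qed.

(** Both vectors are orthogonal to the tangent plane and to b, a space of dimension
    one; the coefficient is not zero because the product of the cross product with l
    is the determinant of the frame. *)
Lemma cross_collinear p b l : U p -> normal_frame p b l ->
  exists2 c : R, c != 0 &
    minkowski_cross ('D_du z p) ('D_dv z p) b = c *: l.
Proof.
move=> Up [nb nl bl [eps epsE [bb ll]]].
have eps0 : eps != 0 by case: epsE => ->; rewrite ?oppr_eq0 oner_neq0.
have bb0 : mink b b != 0 by rewrite bb.
have ll0 : mink l l != 0 by rewrite ll oppr_eq0.
set N := minkowski_cross _ _ _.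
have [Nu Nv Nb] := cross_orthogonal ('D_du z p) ('D_dv z p) b.
have uF := surface_frame_unit hz Up nb nl bl bb0 ll0.
exists (mink N l / mink l l).
  rewrite mulf_neq0 ?invr_eq0 // /N mink_cross.
  by rewrite -unitfE -unitmxE.
apply/eqP; rewrite -subr_eq0; apply/eqP.
apply: (orthogonal_complement_eq0 hz Up nb nl bl bb0 ll0).
- move=> v; rewrite minkC minkBl minkZl nl mulr0 subr0.
  exact: (normal_vector_basis hz Up Nu Nv v).
- by rewrite minkC minkBl minkZl (minkC l) bl mulr0 subr0.
- by rewrite minkC minkBl minkZl divfK // subrr.
Qed.

(** The cross product N of z_u, z_v and b is smooth, and collinear with l at each
    point. Both signs of <b, b> are covered at once by
    normalizing with - <b, b> <N, N>, which is positive. *)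
Lemma smooth_unit_normal (b l : 'rV[R]_2 -> 'rV[R]_4) :
  smooth U b -> (forall p, U p -> normal_frame p (b p) (l p)) ->
  exists nu : 'rV[R]_2 -> 'rV[R]_4, smooth U nu /\
    forall p, U p -> nu p = l p \/ nu p = - l p.
Proof.
move=> sb fr.
pose N p := minkowski_cross ('D_du z p) ('D_dv z p) (b p).
pose s p := - (mink (b p) (b p) * mink (N p) (N p)).
have sN : smooth U N.
  by move=> k; apply: (Ck_cross oU); [exact: (sz k.+1).2|exact: (sz k.+1).2|exact: sb].
have sE p : U p -> exists2 c : R, c != 0 & N p = c *: l p /\ s p = c ^+ 2.
  move=> Up; have [c c0 Nc] := cross_collinear Up (fr p Up).
  exists c => //; split=> //; rewrite /s /N Nc !minkE.
  have [_ _ _ [eps epsE [-> ->]]] := fr p Up.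
  by case: epsE => ->; ring.
have s_gt0 p : U p -> 0 < s p.
  by move=> /sE[c c0 [_ ->]]; rewrite exprn_even_gt0.
have ss k : Ck k U s.
  apply: (Ck_opp oU).
  exact: (Ck_mul oU (Ck_mink oU (sb k) (sb k)) (Ck_mink oU (sN k) (sN k))).
exists (fun p => (Num.sqrt (s p))^-1 *: N p); split.
  move=> k; apply: Ck_mx => // i j.
  have C : Ck k U (fun p => (Num.sqrt (s p))^-1 * N p i j).
    apply: (Ck_mul oU); last exact: (Ck_coord i j oU (sN k)).
    apply: (Ck_inv oU); last exact: Ck_sqrt.
    by move=> p /s_gt0 sp; rewrite gt_eqF // sqrtr_gt0.
  by apply: (Ck_eq oU _ C) => p _; rewrite [RHS]mxE.
move=> p Up; have [c c0 [-> ->]] := sE p Up.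
rewrite scalerA sqrtr_sqr; case: (ltrgt0P c) c0 => // [cp|cn] _.
  by left; rewrite mulVf ?gt_eqF // scale1r.
by right; rewrite invrN mulNr mulVf ?lt_eqF // scaleN1r.
Qed.

(** b and b0 are both collinear with the nonzero vector H, and both have square
    1 or - 1; so they have the same square. *)
Lemma geometric_frame_normal p x y (b b0 l : 'rV[R]_4) (nu1 nu2 lambda mu h : R) :
  geometric_frame z p x y b l nu1 nu2 lambda mu ->
  mean_curvature z p != 0 -> mink b0 b0 = 1 \/ mink b0 b0 = -1 ->
  mean_curvature z p = h *: b0 -> 
  normal_frame p b0 l.
Proof.
move=> [_ [nb nl bl [eps epsE [bb ll]]] [k Hk] _] H0 b0b0 Hh.
have h0 : h != 0 by apply: contraNneq H0; rewrite Hh => ->; rewrite scale0r.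
have [c E] : exists c : R, b0 = c *: b.
  exists (h^-1 * k); rewrite -scalerA -Hk Hh scalerA mulVf // scale1r.
  by [].
have b0E : mink b0 b0 = c ^+ 2 * eps by rewrite E !minkE bb; ring.
have eps0 : eps != 0 by case: epsE => ->; rewrite ?oppr_eq0 oner_neq0.
have c0 : c != 0.
  by apply/eqP => c0; move: b0b0; rewrite b0E c0 expr0n mul0r => -[] /eqP;
    rewrite eq_sym ?oppr_eq0 oner_eq0.
have c2 : 0 < c ^+ 2 by rewrite exprn_even_gt0.
split=> //.
- by move=> v; rewrite E minkZl nb mulr0.
- by rewrite E minkZl bl mulr0.
exists eps => //; split=> //; rewrite b0E.
move: b0b0; rewrite b0E; case: epsE => -> [] H; move: c2 H; rewrite ?mulr1 ?mulrN1.
- by move=> _ ->.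
- by move=> c2 H; move: c2; rewrite H ltr0N1.
- by move=> c2 /eqP; rewrite eqr_oppLR => /eqP H; move: c2; rewrite H ltr0N1.
- by move=> _ ->.
Qed.

End NormalField.

(** * The rank one quadratic forms and their square roots *)

Section PrincipalForm.
Context {R : realType}.
Variables (U : set 'rV[R]_2) (z nu : 'rV[R]_2 -> 'rV[R]_4) (m : 'rV[R]_2 -> R).
Implicit Types (p v w x y : 'rV[R]_2).

(** The form A = (m g + S) / 2, where S(v, w) = - <D_v nu, D_w z>. *)
Definition principal_square p v w : R :=
  (m p * first_form z p v w - mink ('D_v nu p) ('D_w z p)) / 2.

Variable w : 'rV[R]_2.

(** A linear form of square A when A has rank one and A(w, w) > 0. *)
Definition principal_form v p : R :=
  principal_square p w v / Num.sqrt (principal_square p w w).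

(** The ambient vector X with alpha(v) = m <X, D_v z>. *)
Definition principal_vector p : 'rV[R]_4 :=
  (2 * Num.sqrt (principal_square p w w))^-1 *:
    ('D_w z p - (m p)^-1 *: 'D_w nu p).

Hypothesis hz : spacelike_surface U z.
Hypotheses (snu : smooth U nu) (sm : smooth U m).
Hypothesis m_gt0 : forall p, U p -> 0 < m p.
Hypothesis weingarten : forall p v, U p -> exists u, 'D_v nu p = 'D_u z p.
Hypothesis rank1 : forall p v v', U p ->
  principal_square p w v * principal_square p w v' =
  principal_square p w w * principal_square p v v'.
Hypothesis pos : forall p, U p -> 0 < principal_square p w w.

Let oU : open U. Proof. by case: hz. Qed.
Let sz : smooth U z. Proof. by case: hz. Qed.

Lemma smooth_principal_square v v' : smooth U (fun p => principal_square p v v').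
Proof.
move=> k; have cz u : Ck k U ('D_u z) by exact: (sz k.+1).2.
have cnu u : Ck k U ('D_u nu) by exact: (snu k.+1).2.
have C1 := Ck_mul oU (sm k) (Ck_mink oU (cz v) (cz v')).
have C2 := Ck_opp oU (Ck_mink oU (cnu v) (cz v')).
exact: (Ck_mul oU (Ck_add oU C1 C2) (Ck_cst k U (2^-1 : R))).
Qed.

Let root p : R := Num.sqrt (principal_square p w w).

Let root_gt0 p : U p -> 0 < root p.
Proof. by move=> /pos; rewrite sqrtr_gt0. Qed.

Let root2 p : U p -> root p * root p = principal_square p w w.
Proof. by move=> /pos h; rewrite -expr2 sqr_sqrtr // ltW. Qed.

Let Ck_root k : Ck k U root.
Proof. by apply: Ck_sqrt => //; exact: smooth_principal_square. Qed.

Lemma smooth_principal_form v : smooth U (principal_form v).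
Proof.
move=> k; apply: (Ck_mul oU); first exact: smooth_principal_square.
by apply: (Ck_inv oU _ (Ck_root k)) => p /root_gt0; exact: lt0r_neq0.
Qed.

Lemma differentiable_principal_vector p : U p -> differentiable principal_vector p.
Proof.
move=> Up.
have d2 : differentiable (fun p => (2 * root p)^-1) p.
  apply: differentiableV; last by rewrite mulf_neq0 ?gt_eqF // root_gt0.
  exact: (Ck_mul oU (Ck_cst 1 U (2 : R)) (Ck_root 1)).1.
have dmi : differentiable (fun p => (m p)^-1) p.
  by apply: differentiableV; [exact: (sm 1).1|rewrite gt_eqF // m_gt0].
have dz : differentiable ('D_w z) p by exact: ((sz 2).2 w).1.
have dn : differentiable ('D_w nu) p by exact: ((snu 2).2 w).1.
apply/differentiable_mxP => i j.
have -> : (fun q => principal_vector q i j) = (fun q => (2 * root q)^-1) *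
    ((fun q => 'D_w z q i j) - (fun q => (m q)^-1) * (fun q => 'D_w nu q i j)).
  by apply/funext => q; rewrite [LHS]mxE [X in _ * X]mxE [X in _ + X]mxE
    [X in - X]mxE.
apply: differentiableM => //; apply: differentiableB.
  exact: (differentiable_mxP _ _).1.
by apply: differentiableM => //; exact: (differentiable_mxP _ _).1.
Qed.

Lemma principal_form_mul p v v' : U p ->
  principal_form v p * principal_form v' p = principal_square p v v'.
Proof.
move=> Up; rewrite /principal_form mulrACA rank1 // -invfM root2 //.
by rewrite mulrC mulKf // gt_eqF // pos.
Qed.

Lemma principal_form_combination p v v' (s t : R) : U p ->
  principal_form (s *: v + t *: v') p = s * principal_form v p + t * principal_form v' p.
Proof.
move=> Up; rewrite /principal_form /principal_square /first_form.
rewrite (derive_combination hz _ _ _ _ Up).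
move: ('D_w z p) ('D_v z p) ('D_v' z p) ('D_w nu p) => a b c e.
rewrite !minkE; move: (Num.sqrt _)^-1 => r; ring.
Qed.

Let square_split p u v : U p ->
  mink ('D_u z p - (m p)^-1 *: 'D_u nu p) ('D_v z p) =
  2 / m p * principal_square p u v.
Proof.
move=> /m_gt0/lt0r_neq0 m0; rewrite /principal_square /first_form !minkE.
by move: (mink _ _) (mink _ _) => a b; field.
Qed.

Lemma principal_vector_form p v : U p ->
  mink (principal_vector p) ('D_v z p) = principal_form v p / m p.
Proof.
move=> Up; have r0 := lt0r_neq0 (root_gt0 Up); have m0 := lt0r_neq0 (m_gt0 Up).
rewrite /principal_vector minkZl square_split // /principal_form -/(root p).
by field; rewrite r0 m0.
Qed.

Let tangent p u : U p ->
  exists v, 'D_u z p - (m p)^-1 *: 'D_u nu p = 'D_v z p.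
Proof.
move=> Up; have [u' ->] := weingarten u Up.
exists (1 *: u + - (m p)^-1 *: u'); rewrite (derive_combination hz _ _ _ _ Up).
by rewrite scale1r scaleNr.
Qed.

Lemma principal_vector_tangent p : U p -> exists v, principal_vector p = 'D_v z p.
Proof.
move=> Up; have [v vE] := tangent w Up.
exists ((2 * root p)^-1 *: v).
by rewrite (derive_scale _ _ (surface_differentiable hz Up)) /principal_vector vE.
Qed.

(** Both sides are tangent, and their products with D_u z are (2 / m) A(v, u) and
    (2 / m) alpha(v) alpha(u). *)
Lemma principal_splitting p v : U p ->
  'D_v z p - (m p)^-1 *: 'D_v nu p = (2 * principal_form v p) *: principal_vector p.
Proof.
move=> Up; have [u uE] := tangent v Up; have [x xE] := principal_vector_tangent Up.
have m0 := lt0r_neq0 (m_gt0 Up).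
pose k := 1 *: u + - (2 * principal_form v p) *: x.
have kE : 'D_k z p = 'D_v z p - (m p)^-1 *: 'D_v nu p -
    (2 * principal_form v p) *: principal_vector p.
  by rewrite (derive_combination hz _ _ _ _ Up) uE xE scale1r scaleNr.
apply/eqP; rewrite -subr_eq0 -kE.
suff -> : k = 0 by rewrite derive0.
apply: (first_form_eq0 hz Up); rewrite /first_form {1}kE.
rewrite minkBl minkZl square_split // principal_vector_form //.
rewrite -(principal_form_mul v k Up).
by move: (principal_form v p) (principal_form k p) => a b; field.
Qed.

End PrincipalForm.

(** * The second fundamental form along the normal nu *)

Section SecondForm.
Context {R : realType}.
Variables (U : set 'rV[R]_2) (z : 'rV[R]_2 -> 'rV[R]_4).
Hypothesis hz : spacelike_surface U z.
Implicit Types (p v w x y : 'rV[R]_2) (b l : 'rV[R]_4).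

Let oU : open U. Proof. by case: hz. Qed.
Let sz : smooth U z. Proof. by case: hz. Qed.

Lemma derive_expansion p x y v : U p ->
  first_form z p x x = 1 -> first_form z p y y = 1 -> first_form z p x y = 0 ->
  'D_v z p = first_form z p v x *: 'D_x z p + first_form z p v y *: 'D_y z p.
Proof.
move=> Up xx yy xy.
transitivity ('D_(first_form z p v x *: x + first_form z p v y *: y) z p).
  by congr (derive z p _); exact: (orthonormal_expansion hz Up xx yy xy).
exact: (derive_combination hz _ _ _ _ Up).
Qed.

(** Subtract the projection of n on the tangent plane: the difference is orthogonal
    to the whole space. *)
Lemma tangent_of_orthogonal p x y b l (n : 'rV[R]_4) : U p ->
  first_form z p x x = 1 -> first_form z p y y = 1 -> first_form z p x y = 0 ->
  normal_frame z p b l -> mink n b = 0 -> mink n l = 0 -> exists u, n = 'D_u z p.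
Proof.
move=> Up xx yy xy [nb nl bl [eps epsE [bb ll]]] nb0 nl0.
have eps0 : eps != 0 by case: epsE => ->; rewrite ?oppr_eq0 oner_neq0.
have bb0 : mink b b != 0 by rewrite bb.
have ll0 : mink l l != 0 by rewrite ll oppr_eq0.
pose u := mink n ('D_x z p) *: x + mink n ('D_y z p) *: y.
exists u; apply/eqP; rewrite -subr_eq0; apply/eqP.
apply: (orthogonal_complement_eq0 hz Up nb nl bl bb0 ll0) => [v||].
- have uE : 'D_u z p = mink n ('D_x z p) *: 'D_x z p + mink n ('D_y z p) *: 'D_y z p.
    exact: (derive_combination hz _ _ _ _ Up).
  rewrite uE (derive_expansion v Up xx yy xy).
  move: xx yy xy; rewrite /first_form.
  move: ('D_v z p) ('D_x z p) ('D_y z p) => Z X Y xx yy xy.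
  move: (mink Z X) (mink Z Y) => s t.
  by rewrite !minkE (minkC Y X) xx yy xy (minkC X n) (minkC Y n); ring.
- by rewrite minkBr (minkC b n) nb0 nb subr0.
- by rewrite minkBr (minkC l n) nl0 nl subr0.
Qed.

Variable nu : 'rV[R]_2 -> 'rV[R]_4.
Hypothesis snu : smooth U nu.
Hypothesis nu_normal : forall p, U p -> normal_vector z p (nu p).

Lemma derive_nu_tangent p v w : U p ->
  mink ('D_v nu p) ('D_w z p) = - mink ('D_v ('D_w z) p) (nu p).
Proof.
move=> Up; have dn : differentiable nu p by exact: (snu 1).1.
have dz : differentiable ('D_w z) p by exact: ((sz 2).2 w).1.
have E : 'D_v (fun q => mink (nu q) ('D_w z q)) p = 'D_v (cst 0 : _ -> R) p.
  apply: near_eq_derive; apply: (near_open oU Up) => q Uq; exact: nu_normal.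
move: E; rewrite (derive_mink v dn dz) derive_cst => /eqP.
by rewrite addr_eq0 minkC => /eqP; rewrite (minkC (nu p)) minkC.
Qed.

(** S(v, w) = <sigma(v, w), nu>, in the form where linearity in v and w is visible. *)
Definition second_form p v w : R := - mink ('D_v nu p) ('D_w z p).

Lemma second_formC p v w : U p -> second_form p v w = second_form p w v.
Proof.
move=> Up; apply: (congr1 -%R); apply: (eq_trans (derive_nu_tangent v w Up)).
apply: (eq_trans _ (esym (derive_nu_tangent w v Up))); apply: (congr1 -%R).
exact: (congr1 (mink^~ (nu p)) (derive_commutes_mx v w oU (sz 2) Up)).
Qed.

Lemma second_form_sigma p v w : U p -> second_form p v w = mink (sigma z p v w) (nu p).
Proof.
move=> Up; apply: (eq_trans (congr1 -%R (derive_nu_tangent v w Up))).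
rewrite opprK; exact: (esym (sigma_normal v w (nu_normal Up))).
Qed.

Lemma second_form_combination p v w x (s t : R) : U p ->
  second_form p (s *: v + t *: w) x = s * second_form p v x + t * second_form p w x.
Proof.
move=> Up; rewrite (second_formC _ x Up) (second_formC v x Up) (second_formC w x Up) /second_form.
rewrite (derive_combination hz v w s t Up).
by move: ('D_x nu p) ('D_v z p) ('D_w z p) => a c e; rewrite !minkE; ring.
Qed.

Lemma second_form_expansion p x y v w : U p ->
  first_form z p x x = 1 -> first_form z p y y = 1 -> first_form z p x y = 0 ->
  second_form p x x = 0 -> second_form p y y = 0 ->
  second_form p v w = second_form p x y * (first_form z p v x * first_form z p w y +
                               first_form z p v y * first_form z p w x).
Proof.
move=> Up xx yy xy sx sy.
have E u t : second_form p u t = first_form z p u x * second_form p x t +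
                           first_form z p u y * second_form p y t.
  rewrite -(second_form_combination _ _ _ _ _ Up); congr (second_form p _ t).
  exact: (orthonormal_expansion hz Up xx yy xy).
rewrite (E v w) (second_formC x w Up) (second_formC y w Up) (E w x) (E w y) sx sy.
rewrite (second_formC y x Up); move: (second_form p x y) => s.
move: (first_form z p v x) (first_form z p v y) => a c.
by move: (first_form z p w x) (first_form z p w y) => e f; ring.
Qed.

Lemma first_form_expansion p x y v w : U p ->
  first_form z p x x = 1 -> first_form z p y y = 1 -> first_form z p x y = 0 ->
  first_form z p v w = first_form z p v x * first_form z p w x +
                       first_form z p v y * first_form z p w y.
Proof.
move=> Up xx yy xy.
rewrite (first_formC z p w x) (first_formC z p w y).
rewrite -(first_form_combination hz _ _ _ _ _ Up); congr (first_form z p _ w).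
exact: (orthonormal_expansion hz Up xx yy xy).
Qed.

(** sigma(x, x) and sigma(y, y) are along b, orthogonal to nu, and <l, nu> = 1 or -1. *)
Lemma geometric_frame_second_form p x y b l (nu1 nu2 lambda mu : R) : U p ->
  geometric_frame z p x y b l nu1 nu2 lambda mu -> nu p = l \/ nu p = - l ->
  [/\ second_form p x x = 0, second_form p y y = 0 & second_form p x y ^+ 2 = mu ^+ 2].
Proof.
move=> Up [_ [_ _ bl [eps epsE [_ ll]]] _ [sxx sxy syy]] nul.
have bn : mink b (nu p) = 0 by case: nul => ->; rewrite ?minkNr bl ?oppr0.
rewrite (second_form_sigma x x Up) (second_form_sigma x y Up) (second_form_sigma y y Up).
rewrite sxx sxy syy !minkE bn !mulr0 add0r; split=> //.
rewrite exprMn -[RHS]mulr1; congr (_ * _).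
by case: nul => ->; rewrite ?minkNr ll; case: epsE => ->; ring.
Qed.

(** Minus the determinant of S with respect to g. *)
Definition extrinsic_square p : R :=
  (second_form p du dv ^+ 2 - second_form p du du * second_form p dv dv) /
  (first_form z p du du * first_form z p dv dv - first_form z p du dv ^+ 2).

Lemma gram_det_gt0 p : U p ->
  0 < first_form z p du du * first_form z p dv dv - first_form z p du dv ^+ 2.
Proof.
move=> Up; have du0 : du != 0 :> 'rV[R]_2.
  by apply/eqP => /rowP /(_ 0); rewrite !mxE /= => /eqP; rewrite oner_eq0.
have E0 : 0 < first_form z p du du by case: hz => _ _; apply.
pose v := (- first_form z p du dv) *: du + first_form z p du du *: dv.
have v0 : v != 0.
  apply/eqP => /rowP /(_ 1); rewrite !mxE /= mulr0 mulr1 add0r => /eqP.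
  by rewrite gt_eqF.
have vv : first_form z p v v = first_form z p du du *
    (first_form z p du du * first_form z p dv dv - first_form z p du dv ^+ 2).
  rewrite {1}/v (first_form_combination hz _ _ _ _ _ Up).
  rewrite (first_formC z p du v) (first_formC z p dv v) /v.
  rewrite !(first_form_combination hz _ _ _ _ _ Up) (first_formC z p dv du).
  move: (first_form z p du du) (first_form z p du dv) (first_form z p dv dv) => a c e.
  by ring.
have : 0 < first_form z p v v by case: hz => _ _; apply.
by rewrite vv pmulr_rgt0.
Qed.

(** If c is the determinant of du, dv in the orthonormal basis x, y, the determinants
    of g and S are c^2 and - S(x, y)^2 c^2, because S has zero diagonal in x, y. *)
Lemma extrinsic_squareE p x y b l (nu1 nu2 lambda mu : R) : U p ->
  geometric_frame z p x y b l nu1 nu2 lambda mu -> nu p = l \/ nu p = - l ->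
  extrinsic_square p = mu ^+ 2.
Proof.
move=> Up fr nul; have [sx sy sxy] := geometric_frame_second_form Up fr nul.
have [[xx yy xy] _ _ _] := fr.
have D := lt0r_neq0 (gram_det_gt0 Up).
rewrite /extrinsic_square; apply: (canLR (mulfK D)).
rewrite (second_form_expansion du dv Up xx yy xy sx sy).
rewrite (second_form_expansion du du Up xx yy xy sx sy).
rewrite (second_form_expansion dv dv Up xx yy xy sx sy).
rewrite (first_form_expansion du dv Up xx yy xy).
rewrite (first_form_expansion du du Up xx yy xy).
rewrite (first_form_expansion dv dv Up xx yy xy) -sxy.
move: (second_form p x y) (first_form z p du x) (first_form z p du y) => s a c.
by move: (first_form z p dv x) (first_form z p dv y) => e f; ring.
Qed.

Lemma smooth_second_form v w : smooth U (fun p => second_form p v w).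
Proof.
move=> k; apply: (Ck_opp oU).
exact: (Ck_mink oU ((snu k.+1).2 v) ((sz k.+1).2 w)).
Qed.

Lemma smooth_extrinsic_square : smooth U extrinsic_square.
Proof.
move=> k; have sg v w : Ck k U (fun p => first_form z p v w).
  exact: (Ck_mink oU ((sz k.+1).2 v) ((sz k.+1).2 w)).
have sq (f : 'rV[R]_2 -> R) : Ck k U f -> Ck k U (fun p => f p ^+ 2).
  by move=> cf; exact: (Ck_mul oU cf cf).
apply: (Ck_mul oU).
  apply: (Ck_add oU); first exact/sq/smooth_second_form.
  apply: (Ck_opp oU).
  exact: (Ck_mul oU (smooth_second_form du du k) (smooth_second_form dv dv k)).
apply: (Ck_inv oU) => [p /gram_det_gt0/lt0r_neq0 //|].
apply: (Ck_add oU); first exact: (Ck_mul oU (sg du du) (sg dv dv)).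
by apply: (Ck_opp oU); exact/sq/sg.
Qed.

End SecondForm.

(** * The coframe alpha, beta *)

Section PrincipalSquareAtPoint.
Context {R : realType}.
Variables (U : set 'rV[R]_2) (z nu : 'rV[R]_2 -> 'rV[R]_4) (m : 'rV[R]_2 -> R).
Hypothesis hz : spacelike_surface U z.
Hypothesis snu : smooth U nu.
Hypothesis nu_normal : forall p, U p -> normal_vector z p (nu p).
Variables (p x y : 'rV[R]_2) (b l : 'rV[R]_4) (nu1 nu2 lambda mu : R).
Hypothesis Up : U p.
Hypothesis fr : geometric_frame z p x y b l nu1 nu2 lambda mu.
Hypothesis nul : nu p = l \/ nu p = - l.
Hypothesis mE : m p ^+ 2 = mu ^+ 2.

Let psq := principal_square z nu m p.

(** S = 2 s m (x-coordinate)(y-coordinate) with s = 1 or -1, which completes the square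
    of m g. *)
Lemma principal_square_factor : exists2 s : R, s = 1 \/ s = -1 &
  forall v w, psq v w = m p / 2 *
    (first_form z p v x + s * first_form z p v y) *
    (first_form z p w x + s * first_form z p w y).
Proof.
have [sx sy sxy] := geometric_frame_second_form hz snu nu_normal Up fr nul.
have [[xx yy xy] _ _ _] := fr.
have S v w := second_form_expansion hz snu nu_normal v w Up xx yy xy sx sy.
have G v w := first_form_expansion hz v w Up xx yy xy.
have [s sE ss] : exists2 s : R, s = 1 \/ s = -1 & second_form z nu p x y = s * m p.
  move: sxy; rewrite -mE => /eqP; rewrite eqf_sqr => /orP[] /eqP ->.
    by exists 1; [left|rewrite mul1r].
  by exists (-1); [right|rewrite mulN1r].
exists s; first exact: sE.
move=> v w.
have -> : psq v w = (m p * first_form z p v w + second_form z nu p v w) / 2 by [].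
rewrite S G ss; move: (m p) => k.
move: (first_form z p v x) (first_form z p v y) => a c.
move: (first_form z p w x) (first_form z p w y) => e f.
by case: sE => ->; field.
Qed.

Lemma principal_square_rank1 w v v' : psq w v * psq w v' = psq w w * psq v v'.
Proof.
have [s _ E] := principal_square_factor.
pose h u := first_form z p u x + s * first_form z p u y.
have {}E u t : psq u t = m p / 2 * h u * h t by exact: E.
rewrite (E w v) (E w v') (E w w) (E v v').
by move: (m p / 2) (h w) (h v) (h v') => k a c e; ring.
Qed.

(** The vector is x + s y, with the sign s of the factorization. *)
Lemma principal_square_pos : 0 < m p -> exists w, 0 < psq w w.
Proof.
move=> m0; have [s sE E] := principal_square_factor.
have [[xx yy xy] _ _ _] := fr.
exists (1 *: x + s *: y); rewrite E !(first_form_combination hz _ _ _ _ _ Up).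
rewrite xx yy (first_formC z p y x) xy.
move: m0; move: (m p) => k k0.
have -> : k / 2 * (1 * 1 + s * 0 + s * (1 * 0 + s * 1)) *
    (1 * 1 + s * 0 + s * (1 * 0 + s * 1)) = 2 * k by case: sE => ->; field.
by rewrite mulr_gt0.
Qed.

End PrincipalSquareAtPoint.

Lemma half_sum (F : numFieldType) (L : lmodType F) (A B x y : L) (s t : F) :
  A - B = (2 * s) *: x -> A + B = (2 * t) *: y -> A = s *: x + t *: y.
Proof.
move=> E1 E2; apply: (scalerI (a := 2 : F)); first by rewrite pnatr_eq0.
rewrite scalerDr !scalerA -E1 -E2 addrACA addNr addr0.
by rewrite scaler_nat mulr2n.
Qed.

Lemma half_difference (F : numFieldType) (L : lmodType F) (A B x y : L) (k s t : F) :
  k != 0 -> A - k^-1 *: B = (2 * s) *: x -> A + k^-1 *: B = (2 * t) *: y ->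
  B = - k *: (s *: x - t *: y).
Proof.
move=> k0 E1 E2; apply: (scalerI (a := k^-1)); first by rewrite invr_eq0.
rewrite scalerA mulrN mulVf // scaleN1r opprB addrC -scaleNr.
apply: (half_sum (A := k^-1 *: B) (B := A)); last by rewrite addrC.
by rewrite mulrN scaleNr -E1 opprB.
Qed.

Section PlaneForms.
Context {R : realType}.
Implicit Types (f g : 'rV[R]_2 -> R).

Definition plane_form f := forall v v' (s t : R),
  f (s *: v + t *: v') = s * f v + t * f v'.

Lemma pairing_plane_form f v : plane_form f ->
  pairing (\row_j f (delta_mx 0 j)) v = f v.
Proof.
move=> fl; rewrite pairingC pairingE !big_ord_recl big_ord0 !mxE addr0.
rewrite [v in RHS]rV2_basis fl; congr (_ + v 0 _ * f (delta_mx _ _));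
by apply/val_inj.
Qed.

Lemma plane_forms_surjective f g (s t : R) : plane_form f -> plane_form g ->
  (forall v, f v = 0 -> g v = 0 -> v = 0) -> exists v, f v = s /\ g v = t.
Proof.
move=> fl gl inj.
pose M : 'M[R]_2 := \matrix_(i, j)
  (if j == 0 then f (delta_mx 0 i) else g (delta_mx 0 i)).
have mulM v : v *m M = \row_j (if j == 0 then f v else g v).
  apply/rowP => j; rewrite mxE [RHS]mxE -(pairing_plane_form v fl).
  rewrite -(pairing_plane_form v gl) !(pairingC _ v) !pairingE.
  by case: ifP => j0; apply: eq_bigr => i _; rewrite !mxE j0.
have uM : M \in unitmx.
  rewrite -row_free_unit; apply: inj_row_free => v; rewrite mulM => /rowP v0.
  by apply: inj; [have := v0 0|have := v0 1]; rewrite !mxE.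
pose c : 'rV[R]_2 := \row_j (if j == 0 then s else t).
exists (c *m invmx M); have /rowP E := mulM (c *m invmx M).
by have := E 0; have := E 1; rewrite mulmxKV // !mxE /= => <- <-.
Qed.

End PlaneForms.

(** Replacing nu by - nu changes S into - S. So beta and Y are the form and the
    vector that the previous part attaches to - nu, and each fact about them is an
    instance of the one about alpha and X. *)
Section PrincipalCoframe.
Context {R : realType}.
Variables (U : set 'rV[R]_2) (z nu : 'rV[R]_2 -> 'rV[R]_4) (m : 'rV[R]_2 -> R).
Variables w1 w2 : 'rV[R]_2.
Hypothesis hz : spacelike_surface U z.
Hypotheses (snu : smooth U nu) (sm : smooth U m).
Hypothesis m_gt0 : forall p, U p -> 0 < m p.
Hypothesis weingarten : forall p v, U p -> exists u, 'D_v nu p = 'D_u z p.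

Let nuN p := - nu p.

Hypothesis rank1 : forall w p v v', U p ->
  principal_square z nu m p w v * principal_square z nu m p w v' =
  principal_square z nu m p w w * principal_square z nu m p v v'.
Hypothesis rank1N : forall w p v v', U p ->
  principal_square z nuN m p w v * principal_square z nuN m p w v' =
  principal_square z nuN m p w w * principal_square z nuN m p v v'.
Hypothesis pos : forall p, U p -> 0 < principal_square z nu m p w1 w1.
Hypothesis posN : forall p, U p -> 0 < principal_square z nuN m p w2 w2.

Let oU : open U. Proof. by case: hz. Qed.
Let sz : smooth U z. Proof. by case: hz. Qed.

Let snuN : smooth U nuN.
Proof. by move=> k; exact: (Ck_opp oU (snu k)). Qed.

Let DnuN p v : U p -> 'D_v nuN p = - 'D_v nu p.
Proof. by move=> Up; apply: deriveN; apply: diff_derivable; exact: (snu 1).1. Qed.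

Let weingartenN p v : U p -> exists u, 'D_v nuN p = 'D_u z p.
Proof.
move=> Up; have [u uE] := weingarten v Up; exists (- 1 *: u).
rewrite (derive_scale _ _ (surface_differentiable hz Up)) -uE scaleN1r.
exact: DnuN.
Qed.

Let al := principal_form z nu m w1.
Let be := principal_form z nuN m w2.
Let X := principal_vector z nu m w1.
Let Y := principal_vector z nuN m w2.

Lemma coframe_metric p v v' : U p ->
  al v p * al v' p + be v p * be v' p = m p * first_form z p v v'.
Proof.
move=> Up; have E1 := principal_form_mul (rank1 w1) pos v v' Up.
have E2 := principal_form_mul (rank1N w2) posN v v' Up.
apply: (eq_trans (congr2 +%R E1 E2)); rewrite /principal_square.
have -> : mink ('D_v nuN p) ('D_v' z p) = - mink ('D_v nu p) ('D_v' z p).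
  by rewrite (DnuN v Up) minkNl.
by move: (m p * _) (mink _ _) => a c; field.
Qed.

Lemma coframe_derive p v : U p -> 'D_v z p = al v p *: X p + be v p *: Y p.
Proof.
move=> Up.
have E1 := principal_splitting hz m_gt0 weingarten (rank1 w1) pos v Up.
have E2 := principal_splitting hz m_gt0 weingartenN (rank1N w2) posN v Up.
rewrite -/al -/X in E1; rewrite -/be -/Y (DnuN v Up) scalerN opprK in E2.
exact: (half_sum E1 E2).
Qed.

Lemma coframe_weingarten p v : U p ->
  'D_v nu p = - m p *: (al v p *: X p - be v p *: Y p).
Proof.
move=> Up.
have E1 := principal_splitting hz m_gt0 weingarten (rank1 w1) pos v Up.
have E2 := principal_splitting hz m_gt0 weingartenN (rank1N w2) posN v Up.
rewrite -/al -/X in E1; rewrite -/be -/Y (DnuN v Up) scalerN opprK in E2.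
have m0 := lt0r_neq0 (m_gt0 Up).
exact: (half_difference m0 E1 E2).
Qed.

Let al_lin p v v' (s t : R) : U p -> al (s *: v + t *: v') p = s * al v p + t * al v' p.
Proof. by move=> Up; exact: (principal_form_combination nu m w1 hz _ _ _ _ Up). Qed.

Let be_lin p v v' (s t : R) : U p -> be (s *: v + t *: v') p = s * be v p + t * be v' p.
Proof. by move=> Up; exact: (principal_form_combination nuN m w2 hz _ _ _ _ Up). Qed.

Lemma coframe_injective p v : U p -> al v p = 0 -> be v p = 0 -> v = 0.
Proof.
move=> Up a0 b0; apply: (first_form_eq0 hz Up); apply: (mulfI (lt0r_neq0 (m_gt0 Up))).
by rewrite -(coframe_metric v v Up) a0 b0 !mulr0 addr0.
Qed.

Lemma coframe_surjective p (s t : R) : U p -> exists v, al v p = s /\ be v p = t.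
Proof.
move=> Up; apply: (plane_forms_surjective (f := al^~ p) (g := be^~ p)).
- by move=> v v' c d; exact: al_lin.
- by move=> v v' c d; exact: be_lin.
- by move=> v; exact: coframe_injective.
Qed.

(** As alpha and beta are independent, X and Y are the images under dz of the dual
    basis, whose products m g = alpha^2 + beta^2 computes. *)
Lemma coframe_dual p : U p ->
  [/\ mink (X p) (X p) = (m p)^-1, mink (X p) (Y p) = 0 &
      mink (Y p) (Y p) = (m p)^-1].
Proof.
move=> Up; have m0 := lt0r_neq0 (m_gt0 Up).
have [v [av bv]] := coframe_surjective 1 0 Up.
have [w [aw bw]] := coframe_surjective 0 1 Up.
have Xv : X p = 'D_v z p by rewrite (coframe_derive v Up) av bv scale1r scale0r addr0.
have Yw : Y p = 'D_w z p by rewrite (coframe_derive w Up) aw bw scale1r scale0r add0r.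
have G u t : m p * mink ('D_u z p) ('D_t z p) = al u p * al t p + be u p * be t p.
  exact: (esym (coframe_metric u t Up)).
split; apply: (mulfI m0).
- by rewrite Xv G av bv mulfV // mulr0 mulr1 addr0.
- by rewrite Xv Yw G av bv aw bw mulr0 mulr0 mul0r addr0.
- by rewrite Yw G aw bw mulfV // mulr0 mulr1 add0r.
Qed.

(** For beta, [codazzi_closed] is applied to - nu, with the roles of (alpha, X) and
    (beta, Y) exchanged. *)
Lemma coframe_closed p v w : U p ->
  'D_v (al w) p = 'D_w (al v) p /\ 'D_v (be w) p = 'D_w (be v) p.
Proof.
move=> Up.
have dm q : U q -> differentiable m q by exact: (sm 1).1.
have m0 q : U q -> m q != 0 by move=> /m_gt0/lt0r_neq0.
have dX q : U q -> differentiable X q.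
  exact: (differentiable_principal_vector hz snu sm m_gt0 pos).
have dY q : U q -> differentiable Y q.
  exact: (differentiable_principal_vector hz snuN sm m_gt0 posN).
split.
  apply: (codazzi_closed (be := be) (X := X) (Y := Y) oU (sz 2) (snu 2) dX dm m0) => //.
  - by move=> q u Uq; exact: coframe_derive.
  - by move=> q u Uq; exact: coframe_weingarten.
  - by move=> q /coframe_dual[].
  - by move=> q /coframe_dual[].
apply: (codazzi_closed (be := al) (X := Y) (Y := X) oU (sz 2) (snuN 2) dY dm m0) => //.
- by move=> q u Uq; rewrite addrC; exact: coframe_derive.
- move=> q u Uq; rewrite (DnuN u Uq) (coframe_weingarten u Uq).
  by rewrite -scalerN opprB.
- by move=> q /coframe_dual[].
- by move=> q Uq; rewrite minkC; case: (coframe_dual Uq).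
Qed.

(** In the coordinates with du = alpha and dv = beta, m g = du^2 + dv^2. *)
Lemma coframe_coordinates p0 : U p0 ->
  exists (V W : set 'rV[R]_2) (phi : 'rV[R]_2 -> 'rV[R]_2),
    [/\ W p0, W `<=` U, diffeomorphism V W phi & canonical_parameters V (z \o phi) (m \o phi)].

Proof.
move=> Up0.
pose a (i : 'I_2) p : 'rV[R]_2 := \row_j
  (if i == 0 then al (delta_mx 0 j) p else be (delta_mx 0 j) p).
have aE i p v : U p -> pairing (a i p) v = if i == 0 then al v p else be v p.
  move=> Up; rewrite /a; case: (i == 0).
    apply: (pairing_plane_form (f := al^~ p)) => u u' c d; exact: al_lin.
  by apply: (pairing_plane_form (f := be^~ p)) => u u' c d; exact: be_lin.
have aE0 p v : U p -> pairing (a 0 p) v = al v p by exact: (aE 0 p v).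
have aE1 p v : U p -> pairing (a 1 p) v = be v p by exact: (aE 1 p v).
have sa i : smooth U (a i).
  move=> k; apply: Ck_mx => // s j.
  have -> : (fun q => a i q s j) = if i == 0 then al (delta_mx 0 j) else be (delta_mx 0 j).
    by apply/funext => q; rewrite mxE; case: (i == 0).
  case: (i == 0).
    exact: (smooth_principal_form hz snu sm pos).
  exact: (smooth_principal_form hz snuN sm posN).
have sym i p : U p -> ('J (a i) p)^T = 'J (a i) p.
  move=> Up; have da : differentiable (a i) p by exact: (sa i 1).1.
  have E s t : 'J (a i) p s t = 'D_(delta_mx 0 s)
      (if i == 0 then al (delta_mx 0 t) else be (delta_mx 0 t)) p.
    transitivity (('D_(delta_mx 0 s) (a i) p) 0 t).
      by rewrite (deriveEjacobian _ da) -rowE [RHS]mxE.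
    have -> : (if i == 0 then al (delta_mx 0 t) else be (delta_mx 0 t)) =
        fun q => a i q 0 t.
      by apply/funext => q; rewrite mxE; case: (i == 0).
    exact: (esym (derive_coord 0 t (diff_derivable da))).
  apply/matrixP => s t; rewrite mxE (E t s) (E s t).
  have [h1 h2] := coframe_closed (delta_mx 0 t) (delta_mx 0 s) Up.
  by case: (i == 0); [exact: h1|exact: h2].
have inj v : (forall i, pairing (a i p0) v = 0) -> v = 0.
  move=> h; apply: (coframe_injective Up0).
    exact: (eq_trans (esym (aE0 p0 v Up0)) (h 0)).
  exact: (eq_trans (esym (aE1 p0 v Up0)) (h 1)).
have [V [W [phi [Wp0 WU dphi co]]]] := closed_coframe_coordinates oU sa Up0 sym inj.
exists V, W, phi; split=> // q Vq.
have [oV _ _ VW _] := dphi; have Uq : U (phi q) by exact/WU/VW.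
have [dq cq] := co q Vq.
have Ecomp v : 'D_v (z \o phi) q = 'D_('D_v phi q) z (phi q).
  have dz := surface_differentiable hz Uq.
  rewrite (deriveE _ (differentiable_comp dq dz)) (diff_comp dq dz) /=.
  by rewrite (deriveE _ dz) (deriveE _ dq).
have alq v : al ('D_v phi q) (phi q) = v 0 0.
  exact: (eq_trans (esym (aE0 _ _ Uq)) (cq v 0)).
have beq v : be ('D_v phi q) (phi q) = v 0 1.
  exact: (eq_trans (esym (aE1 _ _ Uq)) (cq v 1)).
have G v w : first_form (z \o phi) q v w =
    (m (phi q))^-1 * (v 0 0 * w 0 0 + v 0 1 * w 0 1).
  have m0 := lt0r_neq0 (m_gt0 Uq).
  apply: (eq_trans (congr2 mink (Ecomp v) (Ecomp w))).
  apply: (canRL (mulKf m0)).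
  apply: (eq_trans (esym (coframe_metric ('D_v phi q) ('D_w phi q) Uq))).
  exact: (congr2 +%R (congr2 *%R (alq v) (alq w)) (congr2 *%R (beq v) (beq w))).
have [du0 du1] : (du : 'rV[R]_2) 0 0 = 1 /\ (du : 'rV[R]_2) 0 1 = 0 by rewrite !mxE.
have [dv0 dv1] : (dv : 'rV[R]_2) 0 0 = 0 /\ (dv : 'rV[R]_2) 0 1 = 1 by rewrite !mxE.
have mq : `|m (phi q)| = m (phi q) by rewrite gtr0_norm // m_gt0.
split.
- by apply: (eq_trans (G du du)); rewrite /= du0 du1 mq mulr0 addr0 !mulr1.
- by apply: (eq_trans (G dv dv)); rewrite /= dv0 dv1 mq mulr0 add0r !mulr1.
- by apply: (eq_trans (G du dv)); rewrite /= du0 du1 dv0 dv1 mulr0 mul0r addr0 mulr0.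
Qed.

End PrincipalCoframe.

(** * Existence of canonical parameters *)

Lemma spacelike_subset (R : realType) (U U' : set 'rV[R]_2) (z : 'rV[R]_2 -> 'rV[R]_4) :
  open U' -> U' `<=` U -> spacelike_surface U z -> spacelike_surface U' z.
Proof.
move=> oU' sU [_ sz pz]; split=> // [k|p v /sU]; last exact: pz.
exact: Ck_subset sU (sz k).
Qed.

Lemma open_positive (R : realType) (V : normedModType R) (U : set V) (f : V -> R) :
  open U -> Ck 0 U f -> open (U `&` [set p | 0 < f p]).
Proof.
move=> oU cf; rewrite openE => p [Up fp]; apply: filterI.
  exact: (near_open oU Up).
have c : f @ p --> f p := cf p Up.
by apply: (c [set t : R | 0 < t]); apply: open_nbhs_nbhs; split=> //; exact: open_gt.
Qed.

(** Differentiating <nu, b> = 0 and <nu, nu>^2 = 1 shows that D_v nu is orthogonal to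
    b, because D_v b is tangent, and to nu. Squaring <nu, nu> covers both signs. *)
Lemma parallel_normal_weingarten (R : realType) (U : set 'rV[R]_2)
    (z b nu : 'rV[R]_2 -> 'rV[R]_4) (p x y v : 'rV[R]_2) :
  spacelike_surface U z -> smooth U b -> smooth U nu ->
  (forall q, U q -> normal_frame z q (b q) (nu q)) ->
  (forall q w, U q -> normal_connection z b q w = 0) -> U p ->
  first_form z p x x = 1 -> first_form z p y y = 1 -> first_form z p x y = 0 ->
  exists u, 'D_v nu p = 'D_u z p.
Proof.
move=> hz sb snu nf par Up xx yy xy; have [oU _ _] := hz.
have dnu : differentiable nu p by exact: (snu 1).1.
have db : differentiable b p by exact: (sb 1).1.
have nnu : normal_vector z p (nu p) by case: (nf p Up).
apply: (tangent_of_orthogonal hz Up xx yy xy (nf p Up)).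
  have E : 'D_v (fun q => mink (nu q) (b q)) p = 'D_v (cst 0 : _ -> R) p.
    apply: near_eq_derive; apply: (near_open oU Up) => q /nf[_ _ bn _].
    by rewrite minkC.
  move: E; rewrite (derive_mink v dnu db) derive_cst (minkC (nu p)).
  by rewrite (parallel_orthogonal (par p v Up) nnu) addr0.
pose f q := mink (nu q) (nu q).
have [df Df] := is_derive_mink v dnu dnu.
have fp : f p != 0.
  have [_ _ _ [eps epsE [_ nn]]] := nf p Up; rewrite /f nn.
  by case: epsE => ->; rewrite ?opprK ?oppr_eq0 oner_eq0.
have E : 'D_v (f * f) p = 'D_v (cst 1 : _ -> R) p.
  apply: near_eq_derive; apply: (near_open oU Up) => q /nf[_ _ _ [eps epsE [_ nn]]].
  rewrite -[LHS]/(f q * f q) /f nn mulrNN.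
  by case: epsE => ->; rewrite ?mulrNN mulr1.
have {}Df : 'D_v f p = mink ('D_v nu p) (nu p) + mink ('D_v nu p) (nu p).
  by rewrite Df (minkC (nu p)).
move: E; rewrite (deriveM df df) derive_cst Df -/(f p); clear Df df.
move: (f p) fp (mink ('D_v nu p) (nu p)) => k k0 c E.
have {}E : k * (c + c) + k * (c + c) = 0 by exact: E.
have /eqP : 4 * (k * c) = 0 by rewrite -E; ring.
by rewrite !mulf_eq0 (negPf k0) pnatr_eq0 /= => /eqP.
Qed.

Theorem theorem4p1 (R : realType)
    (U : set 'rV[R]_2) (z : 'rV[R]_2 -> 'rV[R]_4)
    (x y : 'rV[R]_2 -> 'rV[R]_2) (b l : 'rV[R]_2 -> 'rV[R]_4)
    (nu1 nu2 lambda mu : 'rV[R]_2 -> R)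
    (hz : spacelike_surface U z)
    (hH : parallel_normalized_mean_curvature U z)
    (hframe : forall p, U p ->
       geometric_frame z p (x p) (y p) (b p) (l p)
         (nu1 p) (nu2 p) (lambda p) (mu p))
    (p0 : 'rV[R]_2) (hp0 : U p0) (hmu : mu p0 != 0) :
  exists (V W : set 'rV[R]_2) (phi : 'rV[R]_2 -> 'rV[R]_2),
    [/\ W p0, W `<=` U, diffeomorphism V W phi &
        canonical_parameters V (z \o phi) (mu \o phi)].
Proof.
have [oU sz _] := hz; have [H0 [b0 [sb0 b0u b0H b0par]]] := hH.
have nf p : U p -> normal_frame z p (b0 p) (l p).
  move=> Up; have [h _ Hh] := b0H p Up.
  exact: (geometric_frame_normal (hframe p Up) (H0 p Up) (b0u p Up) Hh).
have [nu [snu nuE]] := smooth_unit_normal hz sb0 nf.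
have nfn p : U p -> normal_frame z p (b0 p) (nu p).
  move=> Up; have [nb nl bl [eps epsE [bb ll]]] := nf p Up.
  case: (nuE p Up) => ->; split=> //.
  - by exists eps.
  - by move=> v; rewrite minkNl nl oppr0.
  - by rewrite minkNr bl oppr0.
  - by exists eps => //; rewrite minkNl minkNr opprK.
have nn p : U p -> normal_vector z p (nu p) by move=> /nfn[].
have wein p v : U p -> exists u, 'D_v nu p = 'D_u z p.
  move=> Up; have [[xx yy xy] _ _ _] := hframe p Up.
  exact: (parallel_normal_weingarten v hz sb0 snu nfn b0par Up xx yy xy).
pose nuN p := - nu p.
have snuN : smooth U nuN by move=> k; exact: (Ck_opp oU (snu k)).
have nnN p : U p -> normal_vector z p (nuN p).
  by move=> Up v; rewrite minkNl nn // oppr0.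
have nuNE p : U p -> nuN p = l p \/ nuN p = - l p.
  by move=> /nuE[] h; [right|left]; rewrite /nuN h ?opprK.
pose m2 := extrinsic_square z nu.
have m2E p : U p -> m2 p = mu p ^+ 2.
  by move=> Up; exact: (extrinsic_squareE hz snu nn Up (hframe p Up) (nuE p Up)).
have sm2 : smooth U m2 by exact: (smooth_extrinsic_square hz snu).
(* The square of mu is the smooth function m2, so m = |mu| is smooth where m2 is
   positive. *)
pose U1 := U `&` [set p | 0 < m2 p].
have oU1 : open U1 by exact: (open_positive oU (sm2 0)).
have U1U : U1 `<=` U by move=> p [].
pose m p := Num.sqrt (m2 p).
have m_gt0 p : U1 p -> 0 < m p by move=> [_ h]; rewrite sqrtr_gt0.
have sm : smooth U1 m.
  move=> k; apply: (Ck_sqrt oU1); first by move=> p [].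
  exact: (Ck_subset U1U (sm2 k)).
have mE p : U p -> m p = `|mu p| by move=> Up; rewrite /m m2E // sqrtr_sqr.
have mE2 p : U p -> m p ^+ 2 = mu p ^+ 2.
  by move=> Up; rewrite mE // real_normK // num_real.
have U1p0 : U1 p0 by split=> //=; rewrite m2E // exprn_even_gt0.
have hz1 := spacelike_subset oU1 U1U hz.
have rank1 w p v v' : U p -> principal_square z nu m p w v * principal_square z nu m p w v' =
    principal_square z nu m p w w * principal_square z nu m p v v'.
  move=> Up.
  exact: (principal_square_rank1 hz snu nn Up (hframe p Up) (nuE p Up) (mE2 p Up)).
have rank1N w p v v' : U p ->
    principal_square z nuN m p w v * principal_square z nuN m p w v' =
    principal_square z nuN m p w w * principal_square z nuN m p v v'.
  move=> Up.
  exact: (principal_square_rank1 hz snuN nnN Up (hframe p Up) (nuNE p Up) (mE2 p Up)).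
have [w1 pos1] := principal_square_pos hz snu nn hp0 (hframe p0 hp0)
  (nuE p0 hp0) (mE2 p0 hp0) (m_gt0 p0 U1p0).
have [w2 pos2] := principal_square_pos hz snuN nnN hp0 (hframe p0 hp0)
  (nuNE p0 hp0) (mE2 p0 hp0) (m_gt0 p0 U1p0).
have restrict (U' : set 'rV[R]_2) (f : 'rV[R]_2 -> 'rV[R]_4) :
    U' `<=` U -> smooth U f -> smooth U' f.
  by move=> sU sf k; exact: (Ck_subset sU (sf k)).
(* The constant vectors w1 and w2, chosen at p0, are admissible for the forms of nu
   and - nu on a neighbourhood of p0. *)
pose U2 := U1 `&` [set p | 0 < principal_square z nu m p w1 w1].
have oU2 : open U2.
  apply: (open_positive oU1).
  exact: (smooth_principal_square hz1 (restrict _ _ U1U snu) sm w1 w1 0).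
have U2U1 : U2 `<=` U1 by move=> p [].
pose U3 := U2 `&` [set p | 0 < principal_square z nuN m p w2 w2].
have oU3 : open U3.
  apply: (open_positive oU2); apply: (Ck_subset U2U1).
  exact: (smooth_principal_square hz1 (restrict _ _ U1U snuN) sm w2 w2 0).
have U3U1 : U3 `<=` U1 by move=> p [/U2U1].
have U3U : U3 `<=` U by move=> p /U3U1/U1U.
have U3p0 : U3 p0 by split; [split; [exact: U1p0|exact: pos1]|exact: pos2].
have [V [W [phi [Wp0 WU3 dphi can]]]] :=
  coframe_coordinates (spacelike_subset oU3 U3U hz) (restrict _ _ U3U snu)
    (fun k => Ck_subset U3U1 (sm k)) (fun p h => m_gt0 p (U3U1 p h))
    (fun p v h => wein p v (U3U p h)) (fun w p v v' h => rank1 w p v v' (U3U p h))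
    (fun w p v v' h => rank1N w p v v' (U3U p h))
    (fun p h => proj2 (proj1 h)) (fun p h => proj2 h) U3p0.
exists V, W, phi; split=> // [p /WU3/U3U //|q Vq].
have [_ _ _ VW _] := dphi; have [h1 h2 h3] := can q Vq.
have E : (m \o phi) q = `|(mu \o phi) q| by exact/mE/U3U/WU3/VW.
have EV : `|(m \o phi) q|^-1 = `|(mu \o phi) q|^-1 by rewrite E normr_id.
by split; [exact: eq_trans h1 EV|exact: eq_trans h2 EV|exact: h3].
Qed.
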